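(* Let $\mathcal{P}$ be a planar algebra with modulus $d=[2]$ that is singly generated by an $n$-box $S\in\mathcal{P}_{n,+}$ satisfying the five relations listed in the context. Then any closed diagram in $\mathcal{P}_{0,+}$ is a scalar multiple of the empty diagram (so $\dim(\mathcal{P}_{0,+})=1$).
   Context: A (shaded) planar tangle has an outer disk, finitely many ordered inner disks, finitely many disjoint strings (closed loops, or arcs with endpoints on the boundary circles), an even number of endpoints on each boundary circle, a checkerboard shading of the regions, and a marked point (star) on the boundary of each disk; tangles are taken up to isotopy and compose by insertion. A planar algebra $\mathcal{P}$ is a family of complex vector spaces $\mathcal{P}_{n,\pm}$, $n\ge 0$, with, for each tangle, a multilinear map $\mathcal{P}_{n_1,\pm_1}\otimes\cdots\otimes \mathcal{P}_{n_k,\pm_k}\to \mathcal{P}_{n_0,\pm_0}$, where disk $i$ (disk $0$ being the outer one) has $2n_i$ endpoints and sign $+$ (resp. $-$) if its star lies in an unshaded (resp. shaded) region; these maps are compatible with composition of tangles, and radial tangles with matching stars act as the identity. Elements of $\mathcal{P}_{n,+}$ are called $n$-boxes; they are multiplied by vertical stacking of rectangles with star on the left and $n$ strings at top and bottom. $\mathcal{P}$ has modulus $d$ if any contractible closed loop (either shading) may be removed at the cost of a factor $d$. The empty diagrams are understood to be nonzero. ''Singly generated by $S$'' means that every element is a linear combination of diagrams, i.e. planar tangles with all inner disks filled with copies of $S$; a closed diagram is one with no endpoints on the outer boundary. Write $d=q+q^{-1}$ and $[m]=\frac{q^m-q^{-m}}{q-q^{-1}}$; the quantum integers $[1],\dots,[2n+4]$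 are assumed nonzero. The Jones–Wenzl idempotent $f^{(m)}$ is the unique nonzero idempotent in the Temperley–Lieb algebra on $m$ strings (spanned by non-crossing pairings of $2m$ points, closed loops equal to $d$) killed on both sides by all Jones projections $e_1,\dots,e_{m-1}$ (i.e. capping or cupping two adjacent strings gives $0$). The five relations on $S$: (1) $\rho(S)=-S$, where $\rho(S)$ is $S$ with its star moved past two strings counterclockwise. (2) $S$ is uncappable: connecting any two cyclically adjacent boundary points of $S$ (including the two adjacent to the star) by a cap gives $0$. (3) $S^2=f^{(n)}$. (4) $A= i\,\frac{\sqrt{[n][n+2]}}{[n+1]}\,B$. (5) $C=\frac{[2][2n+4]}{[n+1][n+2]}\,D$. Here $A,B,C,D$ are diagrams with all boundary points on the bottom edge and unshaded leftmost region. $A$: one copy of $S$ with all $2n$ strings going down, its star in the region between its first and second strings from the left, with one further string arching over $S$; the resulting $2n+2$ strings enter the top of $f^{(2n+2)}$, and the bottom of $f^{(2n+2)}$ is the boundary. $B$: two copies of $S$ side by side, each with star on top, joined to each other by $n-1$ parallel strings, each with $n+1$ strings going down; these $2n+2$ strings enter the top of $f^{(2n+2)}$. $C$: one copy of $S$ with all $2n$ strings going down, star on the left, with two parallel strings arching over it; the $2n+4$ strings enter the top of $f^{(2n+4)}$. $D$: three copies of $S$ in a row, each with star on top, adjacent copies joined by $n-1$ parallel strings, the outer copies having $n+1$ strings going down and the middle copy $2$ strings going down; these $2n+4$ strings enter the top of $f^{(2n+4)}$. *)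

(* Defs.v *)
From mathcomp Require Import all_boot all_order all_algebra.
Set Implicit Arguments.
Unset Strict Implicit.
Unset Printing Implicit Defensive.
Import Order.TTheory GRing.Theory Num.Theory.
Local Open Scope ring_scope.

(** * Shaded planar tangles

  Up to planar isotopy every tangle can be drawn in Morse position in a strip
  read from top to bottom, with every inner disk turned so that all of its
  boundary points are on its bottom edge and its star is on its left.  Such a
  picture is a word of layers, each acting on the strings present at its
  height; strings and gaps are numbered from the left starting at 0, and gap p
  is the one immediately to the left of string p.
  - [Cup p] is a local maximum: it inserts two new strings, p and p+1, in gap p;
  - [Cap p] is a local minimum: it joins the strings p and p+1;
  - [Disk p x], with x : X k t, places in gap p an inner disk of sign t filled
    with x; its 2k boundary points become the strings p, ..., p+2k-1 (in
    counterclockwise order from the star).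

  A planar tangle whose outer disk has 2n endpoints is a word going from 0
  strings to 2n strings, the outer star being on the left.  The family X is
  the type of contents of the inner disks.  The value of Z_T at (x_1,...,x_r)
  is written as the action on the word T with x_j in its j-th disk, so that the
  numbering of the disks, which only matches arguments with disks, need not be
  recorded.

  Signs are booleans: [true] is + (unshaded) and [false] is - (shaded). *)

Inductive layer (X : nat -> bool -> Type) : Type :=
| Cup (p : nat)
| Cap (p : nat)
| Disk (p k : nat) (t : bool) (x : X k t).

Arguments Cup {X} p.
Arguments Cap {X} p.
Arguments Disk {X} p {k t} x.

Section Tangles.
Context {X : nat -> bool -> Type}.
Implicit Types (l : layer X) (w : seq (layer X)).

(* Number of strings below layer l when there are m above it and the leftmost
   region has sign s; None if the layer does not fit.  The region in gap p has
   sign s (+) odd p, which must be the sign of a disk placed there. *)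
Definition layer_target (s : bool) (m : nat) l : option nat :=
  match l with
  | Cup p => if (p <= m)%N then Some m.+2 else None
  | Cap p => if (p.+2 <= m)%N then Some (m - 2)%N else None
  | @Disk _ p k t _ =>
      if (p <= m)%N && (t == s (+) odd p) then Some (m + k.*2)%N else None
  end.

Fixpoint target (s : bool) (m : nat) w : option nat :=
  if w is l :: w' then
    if layer_target s m l is Some m' then target s m' w' else None
  else Some m.

(* w is a picture with m strings at the top, m' at the bottom, and leftmost
   region of sign s. *)
Definition is_tangle (s : bool) (m m' : nat) w : bool :=
  target s m w == Some m'.

Definition pos l : nat :=
  match l with Cup p => p | Cap p => p | @Disk _ p _ _ _ => p end.

(* Numbers of strings meeting the non-trivial part of a layer from above and
   from below. *)
Definition width_in l : nat := if l is Cap _ then 2 else 0.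
Definition width_out l : nat :=
  match l with Cup _ => 2 | Cap _ => 0 | @Disk _ _ k _ _ => k.*2 end.

Definition shift (j : nat) l : layer X :=
  match l with
  | Cup p => Cup (j + p)
  | Cap p => Cap (j + p)
  | @Disk _ p _ _ x => Disk (j + p) x
  end.

(* k nested maxima, creating the strings p, ..., p+2k-1. *)
Definition cups (p k : nat) : seq (layer X) := [seq Cup i | i <- iota p k].

(* k nested minima, joining the strings p, ..., p+k-1 with the strings
   p+2k-1, ..., p+k respectively. *)
Definition caps (p k : nat) : seq (layer X) :=
  rev [seq Cap i | i <- iota p k].

(* Elementary planar isotopies: changing the relative height of two features
   that lie side by side, straightening a zigzag, and rotating an inner disk
   by a full turn.  They generate planar isotopy of pictures in Morse position,
   as in the graphical calculus of pivotal categories. *)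
Inductive isotopy_step : seq (layer X) -> seq (layer X) -> Prop :=
| Exchange a b l l0 : (pos l <= pos l0)%N ->
    isotopy_step (a ++ [:: l; shift (width_out l) l0] ++ b)
                 (a ++ [:: shift (width_in l) l0; l] ++ b)
| ZigzagLeft a b p :
    isotopy_step (a ++ [:: Cup p; Cap p.+1] ++ b) (a ++ b)
| ZigzagRight a b p :
    isotopy_step (a ++ [:: Cup p.+1; Cap p] ++ b) (a ++ b)
| FullTurn a b p k t (x : X k t) :
    isotopy_step
      (a ++ cups p k.*2 ++ [:: Disk (p + k.*2) x] ++ caps p k.*2 ++ b)
      (a ++ [:: Disk p x] ++ b).

Fixpoint all_disks (Q : forall k t, X k t -> Prop) w : Prop :=
  match w with
  | [::] => True
  | @Disk _ _ _ _ x :: w' => Q _ _ x /\ all_disks Q w'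
  | _ :: w' => all_disks Q w'
  end.

End Tangles.

(** * Planar algebras *)

(* The action is only meaningful on actual tangles; its values on words that
   are not tangles of the right type are irrelevant junk. *)
Record planarAlgebra (K : fieldType) : Type := PlanarAlgebra {
  box :> nat -> bool -> lmodType K;
  act : forall (s : bool) (n : nat), seq (layer box) -> box n s;
  act_isotopy : forall s n w w',
    is_tangle s 0 n.*2 w -> is_tangle s 0 n.*2 w' ->
    isotopy_step w w' -> act s n w = act s n w';
  act_linear : forall s n a b p k t (c : K) (x y : box k t),
    is_tangle s 0 n.*2 (a ++ [:: Disk p x] ++ b) ->
    act s n (a ++ [:: Disk p (c *: x + y)] ++ b)
    = c *: act s n (a ++ [:: Disk p x] ++ b)
      + act s n (a ++ [:: Disk p y] ++ b);
  act_compose : forall s n a b p k t (w : seq (layer box)),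
    is_tangle s 0 n.*2 (a ++ [:: Disk p (act t k w)] ++ b) ->
    is_tangle t 0 k.*2 w ->
    act s n (a ++ [:: Disk p (act t k w)] ++ b)
    = act s n (a ++ [seq shift p l | l <- w] ++ b);
  act_id : forall n s (x : box n s), act s n [:: Disk 0 x] = x
}.

Arguments act {K} P s n w : rename.

Section PlanarAlgebraNotions.
Variables (K : fieldType) (P : planarAlgebra K).

Definition has_modulus (d : K) : Prop :=
  forall s n a b p, is_tangle s 0 n.*2 (a ++ [:: Cup p; Cap p] ++ b) ->
    act P s n (a ++ [:: Cup p; Cap p] ++ b) = d *: act P s n (a ++ b).

Definition empty_diagram (s : bool) : P 0%N s := act P s 0 [::].

Inductive copy_of (n : nat) (t : bool) (S : P n t) :
  forall k u, P k u -> Prop := CopyOf : copy_of S S.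

(* A diagram with 2m endpoints on the outer boundary. *)
Definition is_diagram (n : nat) (t : bool) (S : P n t) (s : bool) (m : nat)
    (w : seq (layer (box P))) : Prop :=
  is_tangle s 0 m.*2 w /\ all_disks (@copy_of n t S) w.

Definition singly_generated (n : nat) (t : bool) (S : P n t) : Prop :=
  forall s m (x : P m s),
    exists (r : nat) (c : 'I_r -> K) (w : 'I_r -> seq (layer (box P))),
      (forall i, is_diagram S s m (w i)) /\
      x = \sum_(i < r) c i *: act P s m (w i).

End PlanarAlgebraNotions.

Definition one_dimensional (K : fieldType) (V : lmodType K) : Prop :=
  exists2 e : V, e != 0 & forall x : V, exists c : K, x = c *: e.

(** * The Temperley-Lieb algebra and Jones-Wenzl idempotents *)

Definition no_label (k : nat) (t : bool) : Type := void.

Definition tl_word : Type := seq (layer no_label).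

(* Formal linear combinations of string diagrams without inner disks. *)
Definition tl_sum (K : fieldType) : Type := seq (K * tl_word).

Section TemperleyLieb.
Variables (K : fieldType) (d : K) (m : nat).

Definition is_tl_word (w : tl_word) : bool := is_tangle true m m w.

Definition is_tl (f : tl_sum K) : bool := all (fun cw => is_tl_word cw.2) f.

Definition tl_linear (V : lmodType K) (phi : tl_word -> V) (f : tl_sum K) : V :=
  \sum_(cw <- f) cw.1 *: phi cw.2.

(* phi respects isotopy and the removal of closed loops at the cost of d. *)
Definition tl_compatible (V : lmodType K) (phi : tl_word -> V) : Prop :=
  (forall w w', is_tl_word w -> is_tl_word w' -> isotopy_step w w' ->
     phi w = phi w') /\
  (forall a b p, is_tl_word (a ++ [:: Cup p; Cap p] ++ b) ->
     phi (a ++ [:: Cup p; Cap p] ++ b) = d *: phi (a ++ b)).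

(* Equality in the Temperley-Lieb algebra on m strings, i.e. in the quotient
   of the free vector space on diagrams by isotopy and loop = d: two formal
   sums agree there iff every linear map killing the relators (for instance the
   quotient map itself) takes the same value on both.  A diagram without closed
   loops is determined up to isotopy by its non-crossing pairing of the 2m
   endpoints, so these pairings form a basis of the quotient. *)
Definition tl_eq (f g : tl_sum K) : Prop :=
  forall (V : lmodType K) (phi : tl_word -> V),
    tl_compatible phi -> tl_linear phi f = tl_linear phi g.

(* Vertical stacking, f above g. *)
Definition tl_mul (f g : tl_sum K) : tl_sum K :=
  [seq (a.1 * b.1, a.2 ++ b.2) | a <- f, b <- g].

(* d times the Jones projection e_(i+1). *)
Definition tl_e (i : nat) : tl_sum K := [:: (1, [:: Cap i; Cup i])].

Definition is_jones_wenzl (f : tl_sum K) : Prop :=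
  [/\ is_tl f,
      tl_eq (tl_mul f f) f,
      ~ tl_eq f [::] &
      forall i, (i.+1 < m)%N ->
        tl_eq (tl_mul (tl_e i) f) [::] /\ tl_eq (tl_mul f (tl_e i)) [::]].

End TemperleyLieb.

Definition tl_embed (X : nat -> bool -> Type) (w : tl_word) : seq (layer X) :=
  [seq match l with
       | Cup p => Cup p
       | Cap p => Cap p
       | @Disk _ _ _ _ x => match x : void with end
       end | l <- w].

(** * The relations *)

Section Relations.
Variables (K : fieldType) (P : planarAlgebra K) (n : nat) (S : P n true).

(* The diagram w, all of whose strings enter the top of f. *)
Definition act_then_tl (s : bool) (m : nat) (w : seq (layer (box P)))
    (f : tl_sum K) : P m s :=
  tl_linear (fun v => act P s m (w ++ tl_embed (box P) v)) f.

(* An element of the Temperley-Lieb algebra on m strings as an m-box: its m top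
   strings are bent around its right-hand side. *)
Definition tl_box (m : nat) (f : tl_sum K) : P m true :=
  act_then_tl true m (cups 0 m) f.

(* The box x y, with x stacked on top of y: the bottom strings of x are its
   first n strings, the top strings of y are its last n strings in reverse. *)
Definition box_mul (x y : P n true) : P n true :=
  act P true n ([:: Disk 0 y; Disk n.*2 x] ++ caps n n).

(* The first two strings counterclockwise from the star of S become the last
   two. *)
Definition rho : P n true :=
  act P true n (cups 0 2 ++ [:: Disk 2 S] ++ caps 0 2).

(* The second clause joins the two boundary points adjacent to the star: the
   first string is led over the disk and joined to the last one, so that the
   outer star is then in a shaded region. *)
Definition uncappable : Prop :=
  (forall i, (i.+1 < n.*2)%N -> act P true n.-1 [:: Disk 0 S; Cap i] = 0) /\
  act P false n.-1 [:: Cup 0; Disk 1 S; Cap 0; Cap (n.*2 - 2)] = 0.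

(* In diagram A the arch is [Cup 0]; [Cup 1] and [Cap n.*2.+1] lead the last
   string of S over S to its left, which puts the star between the first and
   the second string. *)
Definition diagram_A : seq (layer (box P)) :=
  [:: Cup 0; Cup 1; Disk 2 S; Cap n.*2.+1].
Definition diagram_B : seq (layer (box P)) :=
  [:: Disk 0 S; Disk n.*2 S] ++ caps n.+1 n.-1.
Definition diagram_C : seq (layer (box P)) := cups 0 2 ++ [:: Disk 2 S].
Definition diagram_D : seq (layer (box P)) :=
  [:: Disk 0 S; Disk n.*2 S; Disk (4 * n) S]
  ++ caps (3 * n).+1 n.-1 ++ caps n.+1 n.-1.

End Relations.

(* The usual quotient, extended by continuity to q = 1 and q = -1. *)
Definition qint (K : fieldType) (q : K) (m : nat) : K :=
  if q == q^-1 then m%:R * q ^+ m.-1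
  else (q ^+ m - q ^- m) / (q - q^-1).

(* Main.v *)
(** Idea.  Redrawing strings next to a copy of S as arches over it, relations
  (5) and (4) let S move leftwards across two strings at a time, at the cost of
  creating more copies of S: the Jones-Wenzl idempotent is the identity plus
  terms starting with a minimum, and every minimum placed under diagram A or C
  kills it, rotates S, or frees S of an arch.  So one may assume that all copies
  of S are on the far left of the picture, hence in a row at its top, with a
  Temperley-Lieb diagram below.  Reading the minima of that diagram one by one,
  each joins two neighbouring strings of one copy of S, giving 0, or adds a
  string between two adjacent copies; as soon as n strings join them, relation
  (3) removes both.  While fewer than n strings join adjacent copies every copy
  keeps a free string, so a closed diagram ends with no copy of S. *)
Require Import Defs.
From mathcomp Require Import all_boot all_order all_algebra.
From mathcomp Require Import zify complex reals.
Set Implicit Arguments.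
Unset Strict Implicit.
Unset Printing Implicit Defensive.
Import Order.TTheory GRing.Theory Num.Theory.

(** * Typing of pictures: gluing, widening and shifting *)

Section Pictures.
Context {X : nat -> bool -> Type}.
Implicit Types (l : layer X) (u v w a b : seq (layer X)).

Lemma target_cat s m u v :
  target s m (u ++ v) = obind (fun k => target s k v) (target s m u).
Proof. by elim: u m => //= l u IH m; case: (layer_target s m l). Qed.

Lemma is_tangle_catP s m m' u v :
  reflect (exists2 k, is_tangle s m k u & is_tangle s k m' v)
          (is_tangle s m m' (u ++ v)).
Proof.
rewrite /is_tangle target_cat; case Eu: (target s m u) => [k|] /=.
  apply: (iffP idP) => [Hv|[k' /eqP[<-]]]; by [exists k|].
by apply: (iffP idP) => // -[].
Qed.

Lemma is_tangle_cat s m k m' u v :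
  is_tangle s m k u -> is_tangle s k m' v -> is_tangle s m m' (u ++ v).
Proof. by move=> Hu Hv; apply/is_tangle_catP; exists k. Qed.

Lemma is_tangle_inj s m k k' w :
  is_tangle s m k w -> is_tangle s m k' w -> k = k'.
Proof. by rewrite /is_tangle => /eqP-> /eqP[]. Qed.

Lemma is_tangle_widen s m m' j w :
  is_tangle s m m' w -> is_tangle s (m + j) (m' + j) w.
Proof.
rewrite /is_tangle; elim: w m => [|l w IH] m /=; first by move=> /eqP[->].
case: l => [p|p|p k t x] /=; case: ifP => //=.
- by move=> Hp /IH; rewrite (leq_trans Hp (leq_addr _ _)).
- move=> Hp /IH; rewrite (leq_trans Hp (leq_addr _ _)) /=.
  by rewrite addnBAC // (leq_trans _ Hp).
by move=> /andP[Hp ->] /IH; rewrite (leq_trans Hp (leq_addr _ _)) /= addnAC.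
Qed.

Lemma layer_target_shift s p m j j' l :
  p <= m -> layer_target (s (+) odd p) j l = Some j' ->
  layer_target s (m + j) (shift p l) = Some (m + j').
Proof.
move=> le_pm; case: l => [q|q|q k t x] /=.
- by case: ifP => // Hq [<-]; rewrite ifT; [congr Some|]; lia.
- by case: ifP => // Hq [<-]; rewrite ifT; [congr Some|]; lia.
case: ifP => // /andP[Hq /eqP->] [<-]; rewrite oddD addbA eqxx andbT.
by rewrite ifT; [congr Some|]; lia.
Qed.

Lemma is_tangle_shift s p m j j' w :
  p <= m -> is_tangle (s (+) odd p) j j' w ->
  is_tangle s (m + j) (m + j') [seq shift p l | l <- w].
Proof.
move=> le_pm; rewrite /is_tangle; elim: w j => [|l w IH] j /=.
  by move=> /eqP[->].
case E: (layer_target _ j l) => [j1|] //= /IH.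
by rewrite (layer_target_shift le_pm E).
Qed.

Lemma shift0 w : [seq shift 0 l | l <- w] = w.
Proof. by elim: w => // -[p|p|p k t x] w /= ->. Qed.

Lemma shift_shift p q l : shift p (shift q l) = shift (p + q) l.
Proof. by case: l => /= *; rewrite addnA. Qed.

Lemma target_exchange s m l l0 : pos l <= pos l0 ->
  target s m [:: l; shift (width_out l) l0]
  = target s m [:: shift (width_in l) l0; l].
Proof.
case: l => [p|p|p k t x]; case: l0 => [q|q|q k' t' x'] /= le_pq;
  rewrite ?add0n ?oddD ?odd_double ?addFb ?negbK.
all: try (case: (t == _)); try (case: (t' == _)).
all: rewrite ?andbT ?andbF //; do !(case: ifP => ? //=).
all: by [congr Some; lia | exfalso; lia].
Qed.

Lemma capsS p k : caps p k.+1 = caps p.+1 k ++ [:: Cap p] :> seq (layer X).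
Proof. by rewrite /caps /= rev_cons cats1. Qed.

Lemma is_tangle_caps s p k m :
  p + k.*2 <= m -> is_tangle s m (m - k.*2) (caps p k : seq (layer X)).
Proof.
elim: k p m => [|k IH] p m Hm; first by rewrite subn0 /is_tangle.
rewrite capsS; apply: is_tangle_cat (IH _ _ _) _; first by lia.
by rewrite /is_tangle /= ifT; [apply/eqP; congr Some|]; lia.
Qed.

Lemma is_tangle_cups s p k m :
  p <= m -> is_tangle s m (m + k.*2) (cups p k : seq (layer X)).
Proof.
rewrite /is_tangle; elim: k p m => [|k IH] p m Hm /=; first by rewrite addn0.
rewrite Hm /= (eqP (IH _ _ _)); last by lia.
by apply/eqP; congr Some; lia.
Qed.

End Pictures.

(** * Rewriting inside a picture, up to isotopy and removal of loops *)

Section Reduction.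
Context {X : nat -> bool -> Type} {K : fieldType} {V : lmodType K}.
Variables (d : K) (s : bool) (m m' : nat) (phi : seq (layer X) -> V).
Implicit Types (l : layer X) (u v w a b : seq (layer X)).

Definition compatible : Prop :=
  (forall w w', is_tangle s m m' w -> is_tangle s m m' w' ->
     isotopy_step w w' -> phi w = phi w') /\
  (forall a b p, is_tangle s m m' (a ++ [:: Cup p; Cap p] ++ b) ->
     phi (a ++ [:: Cup p; Cap p] ++ b) = d *: phi (a ++ b))%R.

(** The relation is one-sided: [u'] is only claimed to fit where [u] does, since the empty word left
    by a zigzag fits in more places than the zigzag. *)
Record reduces (c : K) u u' : Prop := Reduces {
  reducesP : forall a b, is_tangle s m m' (a ++ u ++ b) ->
    is_tangle s m m' (a ++ u' ++ b) /\
    phi (a ++ u ++ b) = (c *: phi (a ++ u' ++ b))%R }.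

Hypothesis phiP : compatible.

Lemma reduces_refl u : reduces 1 u u.
Proof. by split=> a b T; rewrite scale1r. Qed.

Lemma reduces_trans c c' u u' u'' :
  reduces c u u' -> reduces c' u' u'' -> reduces (c * c') u u''.
Proof.
case=> H [H']; split=> a b /H[/H'[T E] ->]; split=> //.
by rewrite E scalerA.
Qed.

Lemma reduces_trans1 c u u' u'' :
  reduces 1 u u' -> reduces c u' u'' -> reduces c u u''.
Proof. by rewrite -{2}[c]mul1r; apply: reduces_trans. Qed.

Lemma reduces_cat c a b u u' :
  reduces c u u' -> reduces c (a ++ u ++ b) (a ++ u' ++ b).
Proof.
case=> H; split=> a' b'; rewrite -!catA !(catA a' a) => /H.
by rewrite -!catA.
Qed.

Lemma reduces_catl c a u u' : reduces c u u' -> reduces c (a ++ u) (a ++ u').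
Proof. by move=> /(reduces_cat a [::]); rewrite !cats0. Qed.

Lemma reduces_catr c b u u' : reduces c u u' -> reduces c (u ++ b) (u' ++ b).
Proof. by move=> /(reduces_cat [::] b). Qed.

(** The step behind the tactics [up], [down], [zigl] and [zigr]: it rewrites the layers of index [i]
    and [i+1]. *)
Lemma reduces_at i v c u u' :
  reduces 1 (take 2 (drop i u)) v ->
  reduces c (take i u ++ v ++ drop i.+2 u) u' -> reduces c u u'.
Proof.
move=> H H'; apply: reduces_trans1 H'.
rewrite -{1}(cat_take_drop i u) -{1}(cat_take_drop 2 (drop i u)) drop_drop.
exact: reduces_cat.
Qed.

Lemma reduces_isotopy u u' :
  (forall a b, isotopy_step (a ++ u ++ b) (a ++ u' ++ b) \/
               isotopy_step (a ++ u' ++ b) (a ++ u ++ b)) ->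
  (forall k k', is_tangle s k k' u -> is_tangle s k k' u') ->
  reduces 1 u u'.
Proof.
move=> Hiso Htgt; split=> a b T; have T' : is_tangle s m m' (a ++ u' ++ b).
  move: T => /is_tangle_catP[k Ta /is_tangle_catP[k' Tu Tb]].
  by apply: is_tangle_cat Ta (is_tangle_cat (Htgt _ _ Tu) Tb).
split=> //; rewrite scale1r.
by case: (Hiso a b) => I; [|symmetry]; apply: phiP.1.
Qed.

(** The feature on the right is raised past [l]. The shifted layers enter through equations, so that
    their positions may be given in any arithmetically equal form. *)
Lemma exchange_up l l0 l1 l2 : pos l <= pos l0 ->
  l1 = shift (width_out l) l0 -> l2 = shift (width_in l) l0 ->
  reduces 1 [:: l; l1] [:: l2; l].
Proof.
move=> Hl -> ->; apply: reduces_isotopy => [a b|k k'].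
  by left; apply: Exchange.
by rewrite /is_tangle target_exchange.
Qed.

Lemma exchange_down l l0 l1 l2 : pos l <= pos l0 ->
  l1 = shift (width_out l) l0 -> l2 = shift (width_in l) l0 ->
  reduces 1 [:: l2; l] [:: l; l1].
Proof.
move=> Hl -> ->; apply: reduces_isotopy => [a b|k k'].
  by right; apply: Exchange.
by rewrite /is_tangle target_exchange.
Qed.

Lemma zigzag_left p : reduces 1 [:: Cup p; Cap p.+1] [::].
Proof.
apply: reduces_isotopy => [a b|k k']; first by left; apply: ZigzagLeft.
by rewrite /is_tangle /=; case: ifP => //= _; case: ifP => //= _; rewrite subn2.
Qed.

Lemma zigzag_right p : reduces 1 [:: Cup p.+1; Cap p] [::].
Proof.
apply: reduces_isotopy => [a b|k k']; first by left; apply: ZigzagRight.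
by rewrite /is_tangle /=; case: ifP => //= _; case: ifP => //= _; rewrite subn2.
Qed.

Lemma remove_loop p : reduces d [:: Cup p; Cap p] [::].
Proof.
split=> a b T; split; last exact: phiP.2.
move: T => /is_tangle_catP[k Ta /is_tangle_catP[k' Tu Tb]].
apply: is_tangle_cat Ta _; move: Tu Tb; rewrite /is_tangle /=.
by case: ifP => //= _; case: ifP => //= _; rewrite subn2 => /eqP[->].
Qed.

End Reduction.

Arguments reducesP {X K V s m m' phi c u u'} _ a b _.

(** Pulling [phi] back along an embedding of words into a fixed context is what lets Temperley-Lieb
    identities be applied inside a larger diagram. *)
Lemma compatible_context (X Y : nat -> bool -> Type) (K : fieldType)
    (V : lmodType K) (d : K) s s' m m' k k' (f : seq (layer Y) -> seq (layer X))
    (phi : seq (layer X) -> V) a b :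
  (forall w, is_tangle s' k k' w -> is_tangle s m m' (a ++ f w ++ b)) ->
  (forall u v, f (u ++ v) = f u ++ f v) ->
  (forall u v, isotopy_step u v ->
     isotopy_step (a ++ f u ++ b) (a ++ f v ++ b)) ->
  (forall p, exists q, f [:: Cup p; Cap p] = [:: Cup q; Cap q]) ->
  compatible d s m m' phi ->
  compatible d s' k k' (fun w => phi (a ++ f w ++ b)).
Proof.
move=> Hf fD fI fO [phiI phiO]; split=> [w w' Tw Tw' I|a' b' p T].
  by apply: phiI; [exact: Hf|exact: Hf|exact: fI].
have [q fq] := fO p; have := Hf _ T.
by rewrite !fD fq -!catA !(catA a (f a')) => /phiO.
Qed.

Lemma isotopy_step_cat (X : nat -> bool -> Type) (a b u v : seq (layer X)) :
  isotopy_step u v -> isotopy_step (a ++ u ++ b) (a ++ v ++ b).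
Proof.
case=> [a' b' l l0 Hl|a' b' p|a' b' p|a' b' p k t x];
  rewrite -!catA !(catA a a').
- exact: Exchange.
- exact: ZigzagLeft.
- exact: ZigzagRight.
exact: FullTurn.
Qed.

Lemma compatible_cat (X : nat -> bool -> Type) (K : fieldType)
    (V : lmodType K) (d : K) s m m' k k' (phi : seq (layer X) -> V) a b :
  is_tangle s m k a -> is_tangle s k' m' b ->
  compatible d s m m' phi ->
  compatible d s k k' (fun w => phi (a ++ w ++ b)).
Proof.
move=> Ta Tb; apply: (compatible_context (f := id)) => // [w Tw|u v|p].
- exact: is_tangle_cat Ta (is_tangle_cat Tw Tb).
- exact: isotopy_step_cat.
by exists p.
Qed.

(** * Temperley-Lieb diagrams *)

Section NormalForm.
Context {X : nat -> bool -> Type} {K : fieldType}.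
Variable d : K.
Implicit Types (l : layer X) (u v w a b : seq (layer X)).

Definition flat w : bool :=
  all (fun l => if l is @Disk _ _ _ _ _ then false else true) w.

(** Quantifying over all compatible [phi] stands for equality in the quotient by isotopy and loops,
    so that one normal form serves both formal sums and values in a planar algebra. *)
Definition tl_reduces (c : K) u u' : Prop :=
  forall (V : lmodType K) s m m' (phi : seq (layer X) -> V),
    compatible d s m m' phi -> reduces s m m' phi c u u'.

Lemma tl_reduces_refl u : tl_reduces 1 u u.
Proof. by move=> V s m m' phi _; apply: reduces_refl. Qed.

Lemma tl_reduces_trans c c' u u' u'' :
  tl_reduces c u u' -> tl_reduces c' u' u'' -> tl_reduces (c * c') u u''.
Proof.
move=> H H' V s m m' phi phiP.
exact: reduces_trans (H _ _ _ _ _ phiP) (H' _ _ _ _ _ phiP).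
Qed.

Lemma tl_reduces_cat c a b u u' :
  tl_reduces c u u' -> tl_reduces c (a ++ u ++ b) (a ++ u' ++ b).
Proof.
by move=> H V s m m' phi phiP; apply: reduces_cat; apply: H phiP.
Qed.

(** Equal positions form a loop and positions differing by one a zigzag; otherwise the two features
    lie side by side and the minimum can be raised above the maximum. *)
Lemma cup_cap j i :
  (exists c, tl_reduces c [:: Cup j; Cap i] [::]) \/
  (exists i' j', tl_reduces 1 [:: Cup j; Cap i] [:: Cap i'; Cup j']).
Proof.
case: (ltngtP i j) => [lt_ij|lt_ji|->].
- case: (ltngtP i.+1 j) => [lt_i1j|//|<-]; last first.
  + by left; exists 1%R => V s m m' phi phiP; apply: zigzag_right phiP _.
  + lia.
  right; exists i, (j - 2) => V s m m' phi phiP.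
  apply: (exchange_down phiP (l0 := Cup (j - 2))) => //=; first by lia.
  by congr Cup; lia.
- case: (ltngtP j.+1 i) => [lt_j1i|//|<-]; last first.
  + by left; exists 1%R => V s m m' phi phiP; apply: zigzag_left phiP _.
  + lia.
  right; exists (i - 2), j => V s m m' phi phiP.
  apply: (exchange_up phiP (l0 := Cap (i - 2))) => //=; first by lia.
  by congr Cap; lia.
by left; exists d => V s m m' phi phiP; apply: remove_loop phiP _.
Qed.

Lemma cups_cap ws i : exists c us ws',
  tl_reduces c (map Cup ws ++ [:: Cap i]) (map Cap us ++ map Cup ws').
Proof.
elim/last_ind: ws i => [|ws j IH] i.
  by exists 1%R, [:: i], [::]; apply: tl_reduces_refl.
rewrite map_rcons -cats1 -catA.
case: (cup_cap j i) => [[c H]|[i' [j' H]]].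
  exists c, [::], ws; have := tl_reduces_cat (map Cup ws) [::] H.
  by rewrite !cats0.
have [c [us [ws' H']]] := IH i'.
exists (1 * c)%R, us, (rcons ws' j').
apply: tl_reduces_trans
  (_ : tl_reduces 1 _ (map Cup ws ++ [:: Cap i'; Cup j'])) _.
  by have := tl_reduces_cat (map Cup ws) [::] H; rewrite !cats0.
have := tl_reduces_cat [::] [:: Cup j'] H'.
by rewrite /= map_rcons -cats1 -!catA.
Qed.

(** An appended maximum keeps the form; an appended minimum climbs through the maxima until it
    cancels against one or has passed them all. *)
Lemma flat_normal_form w : flat w -> exists c us ws,
  tl_reduces c w (map Cap us ++ map Cup ws).
Proof.
elim/last_ind: w => [_|w l IH].
  by exists 1%R, [::], [::]; apply: tl_reduces_refl.
rewrite /flat all_rcons -/(flat w) => /andP[Fl /IH[c [us [ws H]]]].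
rewrite -cats1; have {}H := tl_reduces_cat [::] [:: l] H.
case: l Fl H => // p _ H.
  exists c, us, (rcons ws p).
  by move: H; rewrite /= map_rcons -cats1 -!catA.
have [c' [us' [ws' H']]] := cups_cap ws p.
exists (c * c')%R, (us ++ us'), ws'; apply: tl_reduces_trans H _.
have := tl_reduces_cat (map Cap us) [::] H'.
by rewrite /= map_cat !cats0 -!catA.
Qed.

Lemma is_tangle_caps_cups s m m' us ws :
  is_tangle s m m' (map Cap us ++ map Cup ws : seq (layer X)) ->
  m + (size ws).*2 = m' + (size us).*2.
Proof.
rewrite /is_tangle; elim: us m => [|i us IH] m /=.
  elim: ws m => [|j ws IH] m /=; first by move=> /eqP[->].
  by case: ifP => // _ /IH; lia.
by case: ifP => // Hi /IH; lia.
Qed.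

End NormalForm.

(** * Jones-Wenzl idempotents as the identity plus terms starting with a minimum *)

Section JonesWenzl.
Variables (K : fieldType) (d : K) (m : nat).
Implicit Types (f g : tl_sum K) (v w : tl_word).

Lemma flat_tl_word w : flat w.
Proof. by elim: w => //= -[p|p|p k t []]. Qed.

Definition capped (cw : K * tl_word) : bool :=
  is_tl_word m cw.2 && (if cw.2 is Cap _ :: _ then true else false).

Lemma tl_sum_decomposition f : is_tl m f ->
  exists b g, all capped g /\
    forall (V : lmodType K) (phi : tl_word -> V), tl_compatible d m phi ->
      tl_linear phi f = (b *: phi [::] + tl_linear phi g)%R.
Proof.
elim: f => [|[c w] f IH] /=.
  exists 0%R, [::]; split=> // V phi _.
  by rewrite /tl_linear big_nil scale0r addr0.
case/andP=> Tw /IH[b [g [Hg E]]].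
have [c' [us [ws H]]] := flat_normal_form d (flat_tl_word w).
have E1 (V : lmodType K) (phi : tl_word -> V) : tl_compatible d m phi ->
    is_tl_word m (map Cap us ++ map Cup ws) /\
    tl_linear phi ((c, w) :: f) =
    ((c * c') *: phi (map Cap us ++ map Cup ws)
     + (b *: phi [::] + tl_linear phi g))%R.
  move=> phiP; rewrite -(E _ _ phiP) /tl_linear big_cons /=.
  have [] := reducesP (H _ true m m phi phiP) [::] [::].
    by rewrite cats0.
  by rewrite !cats0 => T ->; rewrite scalerA.
(* Typing of the normal form can be read off from any compatible functional; the zero one is at
   hand. *)
have T : is_tl_word m (map Cap us ++ map Cup ws : tl_word).
  have phi0 : tl_compatible d m (fun _ => 0%R : K^o).
    by split=> // *; rewrite scaler0.
  by case: (E1 _ _ phi0).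
(* With as many strings at the top as at the bottom there are as many maxima as minima, so a normal
   form without minima is the identity and contributes to [b]. *)
have := is_tangle_caps_cups T; case: us T E1 {H} => [|i us] T E1 Hsz.
  have {Hsz} ws0 : ws = [::] by case: ws Hsz {T E1} => //= ? ?; lia.
  exists (c * c' + b)%R, g; split=> // V phi phiP.
  by rewrite (E1 _ _ phiP).2 ws0 /= addrA scalerDl.
exists b, ((c * c', map Cap (i :: us) ++ map Cup ws) :: g)%R; split.
  by rewrite /= Hg /capped /= T.
move=> V phi phiP; rewrite (E1 _ _ phiP).2 /tl_linear big_cons /=.
by rewrite addrCA.
Qed.

Lemma tl_linear_eq (V : lmodType K) (phi psi : tl_word -> V) f :
  is_tl m f -> (forall w, is_tl_word m w -> phi w = psi w) ->
  tl_linear phi f = tl_linear psi f.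
Proof.
move=> + E; rewrite /tl_linear; elim: f => [|[c w] f IH] /=.
  by rewrite !big_nil.
by case/andP=> Tw /IH{}IH; rewrite !big_cons IH E.
Qed.

Lemma tl_linearZ (V : lmodType K) (phi : tl_word -> V) c f :
  tl_linear (fun w => c *: phi w)%R f = (c *: tl_linear phi f)%R.
Proof.
rewrite /tl_linear scaler_sumr; apply: eq_bigr => a _.
by rewrite !scalerA mulrC.
Qed.

Lemma tl_linearD (V : lmodType K) (phi psi : tl_word -> V) f :
  tl_linear (fun w => phi w + psi w)%R f
  = (tl_linear phi f + tl_linear psi f)%R.
Proof. by rewrite -big_split; apply: eq_bigr => a _; rewrite scalerDr. Qed.

Lemma tl_linear_swap (V : lmodType K) (phi : tl_word -> tl_word -> V) f g :
  tl_linear (fun v => tl_linear (phi v) g) f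
  = tl_linear (fun w => tl_linear (phi^~ w) f) g.
Proof.
rewrite /tl_linear; under eq_bigr do rewrite scaler_sumr.
rewrite exchange_big; apply: eq_bigr => b _; rewrite scaler_sumr.
by apply: eq_bigr => a _; rewrite !scalerA mulrC.
Qed.

Lemma tl_linear_mul (V : lmodType K) (phi : tl_word -> V) f g :
  tl_linear phi (tl_mul f g)
  = tl_linear (fun u => tl_linear (fun v => phi (u ++ v)) g) f.
Proof.
rewrite /tl_mul /tl_linear big_allpairs_dep; apply: eq_bigr => a _.
by rewrite scaler_sumr; apply: eq_bigr => b _; rewrite scalerA.
Qed.

Lemma tl_compatible_cat (V : lmodType K) (phi : tl_word -> V) a b :
  is_tl_word m a -> is_tl_word m b -> tl_compatible d m phi ->
  tl_compatible d m (fun v => phi (a ++ v ++ b)).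
Proof. exact: compatible_cat. Qed.

(** Putting [tl_e i] above a word that starts with [Cap i] only creates a loop. Hence [f] followed
    by the word is, up to division by [d], a multiple of [f] times [tl_e i], which vanishes. *)
Lemma tl_linear_then_capped (V : lmodType K) (phi : tl_word -> V) f cv :
  d != 0%R -> is_jones_wenzl d m f -> tl_compatible d m phi ->
  capped cv -> tl_linear (fun w => phi (w ++ cv.2)) f = 0%R.
Proof.
case: cv => c v /= d0 [Tf _ _ fe] phiP /andP[/= Tv].
case: v Tv => [|[|i|] v] // Tv _.
have lt_im : i.+1 < m by move: Tv; rewrite /is_tl_word /is_tangle /=; case: ifP.
have Tid : is_tl_word m ([::] : tl_word) by rewrite /is_tl_word /is_tangle /=.
have := (fe i lt_im).2 _ _ (tl_compatible_cat Tid Tv phiP).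
rewrite tl_linear_mul [in RHS]/tl_linear big_nil => E.
apply: (scalerI d0); rewrite scaler0 -{}E -tl_linearZ.
rewrite -/(tl_linear (fun w => tl_linear (fun u => phi (([::] ++ (w ++ u)
  ++ Cap i :: v))) (tl_e K i)) f).
apply: (tl_linear_eq Tf) => w Tw.
rewrite /tl_linear big_cons big_nil addr0 scale1r /= -catA.
have := phiP.2 (w ++ [:: Cap i]) v i; rewrite -!catA /= => -> //.
have := is_tangle_cat Tw Tv; rewrite /is_tl_word /is_tangle !target_cat.
case: (target true m w) => //= k; case: ifP => //= Hk.
by rewrite ifT ?Hk /=; [rewrite ifT ?subn2 //=; lia| lia].
Qed.

(** Write [f = b + g] with [g] capped. Then [f f = b f + f g = b f], since [f g = 0]; as [f f = f]
    and [f] is nonzero, [b = 1]. *)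
Lemma jones_wenzl_decomposition f : d != 0%R -> is_jones_wenzl d m f ->
  exists2 g : tl_sum K, all capped g &
    forall (V : lmodType K) (phi : tl_word -> V), tl_compatible d m phi ->
      tl_linear phi f = (phi [::] + tl_linear phi g)%R.
Proof.
move=> d0 fJW; have [Tf ff f0 _] := fJW.
have [b [g [Hg E]]] := tl_sum_decomposition Tf.
have Tid : is_tl_word m ([::] : tl_word) by rewrite /is_tl_word /is_tangle /=.
suff b1 : b = 1%R.
  by exists g => // V phi phiP; rewrite (E _ _ phiP) b1 scale1r.
apply/eqP/negPn/negP => b1; apply: f0 => V phi phiP.
have := ff V phi phiP; rewrite tl_linear_mul.
rewrite (@tl_linear_eq _ _ (fun u => b *: phi u
    + tl_linear (fun v => phi (u ++ v)) g)%R _ Tf) => [|u Tu]; last first.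
  have Ecat h : tl_linear (fun v => phi (u ++ v ++ [::])) h
      = tl_linear (fun v => phi (u ++ v)) h.
    by apply: eq_bigr => cw _; rewrite cats0.
  by have := E _ _ (tl_compatible_cat Tu Tid phiP); rewrite !Ecat !cats0.
rewrite tl_linearD tl_linearZ tl_linear_swap.
have -> : tl_linear (fun v => tl_linear (fun u => phi (u ++ v)) f) g = 0%R.
  rewrite /tl_linear; elim: (g) Hg => [|v g' IH] /=; first by rewrite big_nil.
  case/andP=> Hv /IH{}IH; rewrite big_cons IH addr0.
  have := tl_linear_then_capped d0 fJW phiP Hv.
  by rewrite /tl_linear => ->; rewrite scaler0.
rewrite addr0.
move=> /eqP; rewrite -subr_eq0 -[X in (_ - X)%R]scale1r -scalerBl scaler_eq0.
by rewrite subr_eq0 (negPf b1) /= => /eqP->; rewrite /tl_linear big_nil.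
Qed.

End JonesWenzl.

(** * Temperley-Lieb words as pictures over any family of contents *)

Lemma tl_embed_cat X (u v : tl_word) :
  tl_embed X (u ++ v) = tl_embed X u ++ tl_embed X v.
Proof. exact: map_cat. Qed.

Lemma is_tangle_embed X s m m' (v : tl_word) :
  is_tangle s m m' (tl_embed X v) = is_tangle s m m' v.
Proof.
rewrite /is_tangle; congr (_ == _).
by elim: v m => //= -[p|p|p k t []] v IH m /=; case: ifP.
Qed.

Lemma isotopy_step_embed X p (u v : tl_word) : isotopy_step u v ->
  isotopy_step [seq shift p l | l <- tl_embed X u]
               [seq shift p l | l <- tl_embed X v].
Proof.
case=> [a b l l0 Hl|a b q|a b q|a b q k t []];
  rewrite !tl_embed_cat !map_cat /=; last 2 first.
- by rewrite addnS; exact: ZigzagLeft.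
- by rewrite addnS; exact: ZigzagRight.
case: l Hl => [q|q|q k t []] /=; case: l0 => [q'|q'|q' k' t' []] /= Hl.
- rewrite addnCA; apply: (@Exchange _ _ _ (Cup _) (Cup _)).
  by rewrite /= leq_add2l.
- rewrite addnCA; apply: (@Exchange _ _ _ (Cup _) (Cap _)).
  by rewrite /= leq_add2l.
- rewrite (addnCA p 2); apply: (@Exchange _ _ _ (Cap _) (Cup _)).
  by rewrite /= leq_add2l.
rewrite (addnCA p 2); apply: (@Exchange _ _ _ (Cap _) (Cap _)).
by rewrite /= leq_add2l.
Qed.

(** * Values of closed diagrams *)

Section ClosedDiagrams.
Variables (K : fieldType) (P : planarAlgebra K) (d : K).
Hypothesis modulusP : has_modulus P d.
Implicit Types (u w a b : seq (layer (box P))) (v : tl_word).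

Definition closed w : bool := is_tangle true 0 0 w.

Definition trivial_value w : Prop :=
  exists c, act P true 0 w = (c *: empty_diagram P true)%R.

Lemma act_compatible s k : compatible d s 0 k.*2 (act P s k).
Proof. by split; [exact: act_isotopy | exact: modulusP]. Qed.

Lemma trivial_value_reduces c a u u' b :
  reduces true 0 0 (act P true 0) c u u' -> closed (a ++ u ++ b) ->
  (closed (a ++ u' ++ b) -> trivial_value (a ++ u' ++ b)) ->
  trivial_value (a ++ u ++ b).
Proof.
move=> H T; have [T' E] := reducesP H _ _ T.
case/(_ T') => c' E'; exists (c * c')%R.
by rewrite E E' scalerA.
Qed.

Lemma closed_disk a b p k t (x y : P k t) :
  closed (a ++ [:: Disk p x] ++ b) = closed (a ++ [:: Disk p y] ++ b).
Proof. by rewrite /closed /is_tangle !target_cat. Qed.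

Lemma act_disk0 a b p k t : closed (a ++ [:: Disk p (0%R : P k t)] ++ b) ->
  act P true 0 (a ++ [:: Disk p (0%R : P k t)] ++ b) = 0%R.
Proof.
(* Linearity with coefficient -1 and both contents 0. *)
move=> T; have := act_linear (-1) 0%R (T : is_tangle true 0 (0.*2) _).
by rewrite scaler0 addr0 scaleN1r addNr.
Qed.

Lemma act_diskZ a b p k t c (x : P k t) : closed (a ++ [:: Disk p x] ++ b) ->
  act P true 0 (a ++ [:: Disk p (c *: x)%R] ++ b)
  = (c *: act P true 0 (a ++ [:: Disk p x] ++ b))%R.
Proof.
move=> T; have := act_linear c 0%R (T : is_tangle true 0 (0.*2) _).
by rewrite addr0 => ->; rewrite act_disk0 ?addr0 // (closed_disk _ _ _ _ x).
Qed.

Lemma act_disk_tl_linear a b p k t (y : tl_word -> P k t) (f : tl_sum K) :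
  closed (a ++ [:: Disk p (0%R : P k t)] ++ b) ->
  act P true 0 (a ++ [:: Disk p (tl_linear y f)] ++ b)
  = tl_linear (fun v => act P true 0 (a ++ [:: Disk p (y v)] ++ b)) f.
Proof.
move=> T; rewrite /tl_linear; elim: f => [|cv f IH].
  by rewrite !big_nil act_disk0.
rewrite !big_cons -IH; apply: act_linear.
by move: T; rewrite (closed_disk _ _ _ _ (y cv.2)).
Qed.

Lemma closed_insert a b p k t (x : P k t) w :
  closed (a ++ [:: Disk p x] ++ b) -> is_tangle t 0 k.*2 w ->
  closed (a ++ [seq shift p l | l <- w] ++ b).
Proof.
case/is_tangle_catP=> m Ta /is_tangle_catP[m' Tx Tb] Tw.
apply: is_tangle_cat Ta (is_tangle_cat _ Tb).
move: Tx; rewrite /is_tangle /=.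
case: ifP => // /andP[le_pm /eqP Et] /eqP[<-].
rewrite -[X in target _ X]addn0; apply: is_tangle_shift => //.
by rewrite addTb -Et.
Qed.

(** As [w] starts from 0 strings, its first layer is a maximum or a disk, whose position certifies
    that gap [p] exists; the empty word would give no bound on [p]. *)
Lemma closed_extract a b p k t (x : P k t) w :
  t = ~~ odd p -> w <> [::] -> is_tangle t 0 k.*2 w ->
  closed (a ++ [seq shift p l | l <- w] ++ b) ->
  closed (a ++ [:: Disk p x] ++ b).
Proof.
move=> Et w0 Tw /is_tangle_catP[m Ta /is_tangle_catP[m' Tsw Tb]].
have le_pm : p <= m.
  case: w w0 Tw Tsw => // -[q|q|q k' t' x'] w _;
    rewrite /is_tangle /=; do !(case: ifP => //= ?); lia.
apply: is_tangle_cat Ta (is_tangle_cat _ Tb).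
rewrite /is_tangle /= le_pm Et eqxx /=.
have := @is_tangle_shift _ true p m 0 k.*2 w le_pm.
rewrite addTb -Et addn0 => /(_ Tw) /(is_tangle_inj Tsw) ->.
exact: eqxx.
Qed.

Lemma act_insert a b p k t w :
  t = ~~ odd p -> w <> [::] -> is_tangle t 0 k.*2 w ->
  closed (a ++ [seq shift p l | l <- w] ++ b) ->
  act P true 0 (a ++ [seq shift p l | l <- w] ++ b)
  = act P true 0 (a ++ [:: Disk p (act P t k w)] ++ b).
Proof.
move=> Et w0 Tw T; rewrite act_compose //.
exact: closed_extract Et w0 Tw T.
Qed.

Lemma trivial_value0 w : act P true 0 w = 0%R -> trivial_value w.
Proof. by move=> E; exists 0%R; rewrite E scale0r. Qed.

Lemma trivial_value_vanish a b p k t w :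
  t = ~~ odd p -> w <> [::] -> is_tangle t 0 k.*2 w -> act P t k w = 0%R ->
  closed (a ++ [seq shift p l | l <- w] ++ b) ->
  trivial_value (a ++ [seq shift p l | l <- w] ++ b).
Proof.
move=> Et w0 Tw E T; apply: trivial_value0.
rewrite (act_insert Et w0 Tw T) E act_disk0 //.
exact: closed_extract Et w0 Tw T.
Qed.

Lemma trivial_value_linear (Q : pred tl_word) (psi : tl_word -> P 0 true)
    (f : tl_sum K) :
  all (fun cv => Q cv.2) f ->
  (forall v, Q v -> exists c, psi v = (c *: empty_diagram P true)%R) ->
  exists c, tl_linear psi f = (c *: empty_diagram P true)%R.
Proof.
move=> + H; rewrite /tl_linear; elim: f => [_|[c v] f IH] /=.
  by exists 0%R; rewrite big_nil scale0r.
case/andP=> /H[c1 E1] /IH[c2 E2]; exists (c * c1 + c2)%R.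
by rewrite big_cons E2 /= E1 scalerA scalerDl.
Qed.

Lemma act_insert_tl a b p k w (f : tl_sum K) :
  ~~ odd p -> w <> [::] -> is_tangle true 0 k.*2 w -> is_tl k.*2 f ->
  closed (a ++ [seq shift p l | l <- w] ++ b) ->
  tl_linear (fun v => act P true 0
    ((a ++ [seq shift p l | l <- w])
     ++ [seq shift p l | l <- tl_embed (box P) v] ++ b)) f
  = act P true 0 (a ++ [:: Disk p (act_then_tl true k w f)] ++ b).
Proof.
move=> p_even w0 Tw Tf T.
have Td (x : P k true) : closed (a ++ [:: Disk p x] ++ b).
  by apply: closed_extract w0 Tw T; rewrite p_even.
rewrite act_disk_tl_linear //; apply: tl_linear_eq Tf _ => v Tv.
rewrite act_compose //; first by rewrite map_cat -!catA.
by apply: is_tangle_cat Tw _; rewrite is_tangle_embed.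
Qed.

(** Expanding [f] under [w1] as the identity plus capped terms isolates the value of [w1]: it is [c]
    times that of [w2] followed by [f], minus values of [w1] followed by words that start with a
    minimum. Only these two kinds of diagrams remain to be treated. *)
Lemma trivial_value_jones_wenzl a b p k w1 w2 (f : tl_sum K) c :
  d != 0%R -> is_jones_wenzl d k.*2 f ->
  is_tangle true 0 k.*2 w1 -> is_tangle true 0 k.*2 w2 ->
  w1 <> [::] -> w2 <> [::] -> ~~ odd p ->
  act_then_tl true k w1 f = (c *: act_then_tl true k w2 f)%R ->
  closed (a ++ [seq shift p l | l <- w1] ++ b) ->
  (forall v, is_tl_word k.*2 v ->
     let w := a ++ [seq shift p l | l <- w2] ++
              [seq shift p l | l <- tl_embed (box P) v] ++ b in
     closed w -> trivial_value w) ->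
  (forall i v, is_tl_word k.*2 (Cap i :: v) ->
     let w := a ++ [seq shift p l | l <- w1] ++ Cap (p + i) ::
              [seq shift p l | l <- tl_embed (box P) v] ++ b in
     closed w -> trivial_value w) ->
  trivial_value (a ++ [seq shift p l | l <- w1] ++ b).
Proof.
move=> d0 fJW Tw1 Tw2 w1_0 w2_0 p_even E T H2 H1.
have [g Hg Eg] := jones_wenzl_decomposition d0 fJW.
have Tf : is_tl k.*2 f by case: fJW.
have Td (x : P k true) : closed (a ++ [:: Disk p x] ++ b).
  by apply: closed_extract w1_0 Tw1 T; rewrite p_even.
have Tc w v : is_tangle true 0 k.*2 w -> is_tl_word k.*2 v ->
    closed (a ++ [seq shift p l | l <- w]
              ++ [seq shift p l | l <- tl_embed (box P) v] ++ b).
  move=> Tw Tv; have := closed_insert (Td 0%R) (is_tangle_cat Tw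
    (_ : is_tangle true _ _ (tl_embed _ v))).
  by rewrite map_cat -!catA; apply; rewrite is_tangle_embed.
pose phi w v := act P true 0 ((a ++ [seq shift p l | l <- w])
  ++ [seq shift p l | l <- tl_embed (box P) v] ++ b).
have phiP : tl_compatible d k.*2 (phi w1).
  apply: (compatible_context
    (f := fun v => [seq shift p l | l <- tl_embed (box P) v])
    _ _ _ _ (act_compatible true 0)) => [v Tv|u v|u v I|q].
  - by rewrite -catA; apply: Tc.
  - by rewrite tl_embed_cat map_cat.
  - by apply: isotopy_step_cat; apply: isotopy_step_embed.
  by exists (p + q).
have := act_insert_tl p_even w1_0 Tw1 Tf T.
rewrite -/(phi w1) E act_diskZ //.
rewrite -(act_insert_tl p_even w2_0 Tw2 Tf);
  last exact: closed_insert (Td 0%R) Tw2.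
rewrite (Eg _ _ phiP) => /eqP; rewrite eq_sym -subr_eq => /eqP.
have [c2 ->] : exists c2, tl_linear (phi w2) f = (c2 *: empty_diagram P true)%R.
  apply: trivial_value_linear Tf _ => v Tv.
  have [c' E'] := H2 v Tv (Tc _ _ Tw2 Tv).
  by exists c'; rewrite -E' /phi -catA.
have [c1 ->] : exists c1, tl_linear (phi w1) g = (c1 *: empty_diagram P true)%R.
  apply: (@trivial_value_linear
    (fun v => if v is Cap _ :: _ then is_tl_word k.*2 v else false)).
    elim: (g) Hg => //= -[c' [|[?|?|? ? ? ?] v]] g' IH //.
      by case/andP=> /andP[].
      by case/andP=> /andP[].
    by case/andP=> /andP[Tv _] /IH->; rewrite Tv.
  case=> [//|[//|i|//] v] Tv; have [c' E'] := H1 i v Tv (Tc _ _ Tw1 Tv).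
  by exists c'; rewrite -E' /phi -catA.
rewrite scalerA -scalerBl => E'; exists (c * c2 - c1)%R.
by rewrite E' /phi -catA.
Qed.

(** * Diagrams in copies of S, with control of the gaps that hold them *)

Variables (n : nat) (S : P n true).
Hypotheses (n_gt0 : 0 < n) (uncap_S : uncappable S).

(** [Q] restricts only the gaps that hold copies of S. The motion of S to the left is recorded by
    shrinking [Q] down to [pred1 0]. *)
Inductive generated_layer (Q : pred nat) : layer (box P) -> Prop :=
| GenCup p : generated_layer Q (Cup p)
| GenCap p : generated_layer Q (Cap p)
| GenDisk p : Q p -> generated_layer Q (Disk p S).

Fixpoint generated (Q : pred nat) w : Prop :=
  if w is l :: w' then generated_layer Q l /\ generated Q w' else True.

Lemma generated_disk p : generated_layer (pred1 p) (Disk p S).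
Proof. by constructor; rewrite /= eqxx. Qed.

Lemma generated_cat Q u w :
  generated Q (u ++ w) <-> generated Q u /\ generated Q w.
Proof. by elim: u => [|l u IH] /=; [tauto | rewrite IH; tauto]. Qed.

Lemma generated_sub (Q Q' : pred nat) w :
  {subset Q <= Q'} -> generated Q w -> generated Q' w.
Proof.
move=> sQ; elim: w => //= l w IH [Hl /IH]; split=> //.
by case: Hl => *; constructor; apply: sQ.
Qed.

Lemma generated_shift (Q Q' : pred nat) p w :
  (forall q, Q q -> Q' (p + q)) -> generated Q w ->
  generated Q' [seq shift p l | l <- w].
Proof.
move=> QQ'; elim: w => //= l w IH [Hl /IH]; split=> //.
by case: Hl => *; constructor; auto.
Qed.

Lemma generated_embed Q p v :
  generated Q [seq shift p l | l <- tl_embed (box P) v].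
Proof. by elim: v => //= -[q|q|q k t []] v IH; split=> //=; constructor. Qed.

Lemma generated_caps Q p k : generated Q (caps p k).
Proof.
elim: k p => // k IH p; rewrite capsS; apply/generated_cat.
by do !split=> //; constructor.
Qed.

Lemma generated_cups Q p k : generated Q (cups p k).
Proof. by elim: k p => //= k IH p; split; [constructor | apply: IH]. Qed.

Local Notation reduces := (reduces true 0 0 (act P true 0)).
Let phiP : compatible d true 0 0 (act P true 0) := act_compatible true 0.

Local Notation cap := (@Cap (box P)).
Local Notation cup := (@Cup (box P)).
Local Notation disk p := (@Disk (box P) p n true S).

Ltac tangle := rewrite /is_tangle /=;
  do ?(case: ifP => /= ?; last by exfalso; lia);
  by [| apply/eqP; congr Some; lia].

Ltac layer_eq := rewrite /=; by [| lia | congr Cap; lia | congr Cup; lia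
  | congr (disk _); lia ].

(** The layers [i] and [i+1] become [l1] and [l2]: [up] raises and [down] lowers the right-hand
    feature, which is [l0] before any shift; [zigl] and [zigr] straighten a zigzag at [i]. *)
Ltac up i l0 l1 l2 := apply: (@reduces_at _ _ _ _ _ _ _ i [:: l1; l2]);
  [ rewrite /=; apply: (exchange_up phiP (l0 := l0)); layer_eq | rewrite /=].
Ltac down i l0 l1 l2 := apply: (@reduces_at _ _ _ _ _ _ _ i [:: l1; l2]);
  [ rewrite /=; apply: (exchange_down phiP (l0 := l0)); layer_eq | rewrite /=].
Ltac zigl i := apply: (@reduces_at _ _ _ _ _ _ _ i [::]);
  [ exact: zigzag_left phiP _ | rewrite /=].
Ltac zigr i := apply: (@reduces_at _ _ _ _ _ _ _ i [::]);
  [ exact: zigzag_right phiP _ | rewrite /=].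

Lemma capped_disk_vanishes a b p i : i.+1 < n.*2 ->
  closed (a ++ [:: Disk p S; Cap (p + i)] ++ b) ->
  trivial_value (a ++ [:: Disk p S; Cap (p + i)] ++ b).
Proof.
move=> Hi T.
have p_even : ~~ odd p.
  move: T; rewrite /closed /is_tangle target_cat.
  by case: (target true 0 a) => //= m; case: ifP => // /andP[].
have := @trivial_value_vanish a b p n.-1 true [:: Disk 0 S; Cap i].
rewrite /= addn0; apply=> //; first by tangle.
exact: uncap_S.1.
Qed.

(** * Moving S to the left *)

Section Rotation.
Hypothesis rho_S : rho S = (- S)%R.

Lemma disk_rotation p : reduces (-1) [:: Disk p S]
  [:: Cup p; Cup p.+1; Disk p.+2 S; Cap p.+1; Cap p].
Proof.
have Trho : is_tangle true 0 n.*2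
    (cups 0 2 ++ [:: Disk 2 S] ++ caps 0 2 : seq (layer (box P))).
  tangle.
have Ew : [:: Cup p; Cup p.+1; Disk p.+2 S; Cap p.+1; Cap p]
   = [seq shift p l | l <- cups 0 2 ++ [:: Disk 2 S] ++ caps 0 2]
   :> seq (layer (box P)).
  by rewrite /= addn0 addn1 addn2.
split=> a b T; rewrite Ew; split; first exact: closed_insert T Trho.
have Td x : closed (a ++ [:: Disk p (x : P n true)] ++ b).
  by move: T; rewrite -/(closed _) (closed_disk _ _ _ _ x).
rewrite -(@act_compose _ P true 0 a b p n true) //.
rewrite -/(rho S) rho_S -[(- S)%R]scaleN1r act_diskZ //.
by rewrite scalerA mulrNN mulr1 scale1r.
Qed.

(* The last two strings of S turned back over it on the left: rotating S first
   by [disk_rotation] undoes this turn. *)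
Lemma disk_counterrotation p : reduces (-1)
  [:: Cup p; Cup p.+1; Disk p.+2 S; Cap (p + n.*2.+1); Cap (p + n.*2)]
  [:: Disk p S].
Proof.
rewrite -[(-1)%R]mulr1; apply: reduces_trans.
  exact: (reduces_cat [:: Cup p; Cup p.+1]
            [:: Cap (p + n.*2.+1); Cap (p + n.*2)] (disk_rotation p.+2)).
rewrite /=.
up 6 (cap (p + n.*2.+1)) (cap (p + n.*2.+3)) (cap p.+2).
up 5 (cap (p + n.*2.+3)) (cap (p + n.*2 + 5)) (cap p.+3).
up 4 (cap (p + 5)) (cap (p + 5)) (disk p.+4).
up 3 (cap p.+3) (cap p.+3) (cup p.+3).
zigl 2.
up 5 (cap (p + n.*2)) (cap (p + n.*2.+2)) (cap p.+2).
up 4 (cap (p + n.*2.+2)) (cap (p + n.*2 + 4)) (cap p.+3).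
up 3 (cap p.+4) (cap p.+4) (disk p.+4).
zigl 2.
up 1 (disk p.+2) (disk p.+2) (cup p.+1).
up 0 (disk p) (disk p) (cup p).
up 2 (cap p.+1) (cap p.+1) (cup p.+1).
zigl 1.
zigl 1.
exact: reduces_refl.
Qed.

(** Leading the last string over S to the left and leading the first one over S to the right differ
    by a rotation by two strings, hence by a sign. *)
Lemma arch_rotation p : reduces (-1)
  [:: Cup p; Disk p.+1 S; Cap (p + n.*2)] [:: Cup p; Disk p.+1 S; Cap p].
Proof.
rewrite -[(-1)%R]mulr1; apply: reduces_trans.
  exact: (reduces_cat [:: Cup p] [:: Cap (p + n.*2)] (disk_rotation p.+1)).
rewrite /=.
up 5 (cap (p + n.*2)) (cap (p + n.*2.+2)) (cap p.+1).
up 4 (cap (p + n.*2.+2)) (cap (p + n.*2 + 4)) (cap p.+2).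
up 3 (cap p.+4) (cap p.+4) (disk p.+3).
up 2 (cap p.+2) (cap p.+2) (cup p.+2).
zigl 1.
up 0 (cup p) (cup p) (cup p).
up 1 (disk p.+1) (disk p.+1) (cup p).
up 2 (cap p) (cap p) (cup p).
zigl 3.
exact: reduces_refl.
Qed.

Lemma arch_rotation_inv p : reduces (-1)
  [:: Cup p; Disk p.+1 S; Cap p] [:: Cup p; Disk p.+1 S; Cap (p + n.*2)].
Proof.
split=> a b T.
have T' : closed (a ++ [:: Cup p; Disk p.+1 S; Cap (p + n.*2)] ++ b).
  move: T; rewrite /closed /is_tangle !target_cat.
  case: (target true 0 a) => //= m; case: ifP => //= Hp; case: ifP => //= Hd.
  by do 2!(rewrite ifT /=; last by lia).
split=> //; have [_ ->] := reducesP (arch_rotation p) _ _ T'.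
by rewrite scalerA mulrNN mulr1 scale1r.
Qed.

Section Arches.
Variables (f2 f4 : tl_sum K) (c2 c4 : K).
Hypothesis d_neq0 : d != 0%R.
Hypotheses (f2P : is_jones_wenzl d n.+1.*2 f2).
Hypotheses (f4P : is_jones_wenzl d n.+2.*2 f4).
Hypothesis relA : act_then_tl true n.+1 (diagram_A S) f2
  = (c2 *: act_then_tl true n.+1 (diagram_B S) f2)%R.
Hypothesis relC : act_then_tl true n.+2 (diagram_C S) f4
  = (c4 *: act_then_tl true n.+2 (diagram_D S) f4)%R.

(** Relation (4) replaces A by B, whose two copies of S can both be drawn in gap [p]; a minimum
    under A gives 0 or leaves one copy of S, in gap [p]. *)
Lemma trivial_value_A a b p : ~~ odd p ->
  closed (a ++ [:: Cup p; Cup p.+1; Disk p.+2 S; Cap (p + n.*2.+1)] ++ b) ->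
  (forall g, generated (pred1 p) g -> closed (a ++ g ++ b) ->
     trivial_value (a ++ g ++ b)) ->
  trivial_value
    (a ++ [:: Cup p; Cup p.+1; Disk p.+2 S; Cap (p + n.*2.+1)] ++ b).
Proof.
move=> p_even T Hg.
have EA : [:: Cup p; Cup p.+1; Disk p.+2 S; Cap (p + n.*2.+1)]
    = [seq shift p l | l <- diagram_A S].
  by rewrite /= addn0 addn1 addn2.
rewrite EA in T *.
apply: (trivial_value_jones_wenzl d_neq0 f2P) relA T _ _ => //.
- by tangle.
- rewrite /diagram_B /=.
  apply: is_tangle_cat (_ : is_tangle true 0 (4 * n) [:: _; _]) _.
    by tangle.
  have := @is_tangle_caps (box P) true n.+1 n.-1 (4 * n).
  have -> : 4 * n - n.-1.*2 = n.+1.*2 by lia.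
  by apply; lia.
- move=> v _ /=; rewrite addn0 => T.
  set V := [seq shift p l | l <- tl_embed _ v] in T *.
  (* Drawing the right-hand copy first places both disks in gap [p]. *)
  apply: (@trivial_value_reduces 1 a [:: Disk p S; Disk (p + n.*2) S]
    [:: Disk p S; Disk p S] _ _ T).
    apply: (exchange_up phiP (l0 := disk p)); layer_eq.
  have := Hg ([:: disk p; disk p]
    ++ [seq shift p l | l <- caps n.+1 n.-1] ++ V).
  rewrite -!catA; apply=> //; apply/generated_cat; split.
    by do !split; exact: generated_disk.
  apply/generated_cat; split; last exact: generated_embed.
  exact: (@generated_shift pred0) (generated_caps _ _ _).
move=> i v Tv /=; set V := [seq shift p l | l <- tl_embed _ v].
have lt_i : i.+1 < n.+1.*2.
  by move: Tv; rewrite /is_tl_word /is_tangle /=; case: ifP.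
have {}Hg g : generated (pred1 p) g -> closed (a ++ g ++ V ++ b) ->
    trivial_value (a ++ g ++ V ++ b).
  move=> Gg; have := Hg (g ++ V); rewrite -!catA; apply.
  by apply/generated_cat; split; last exact: generated_embed.
rewrite addn0 addn1 addn2 => {}T.
(* The minima 0 and 2n join an end of the arch to S and turn it, the minimum 1
   joins the strings on both sides of the star, and the other ones join
   neighbouring strings of S. *)
case: (ltngtP i 1) lt_i T => [lt_i1|lt_1i|->] lt_i T; last first.
- have R : reduces 1
      [:: Cup p; Cup p.+1; Disk p.+2 S; Cap (p + n.*2.+1); Cap (p + 1)]
      ([:: Cup p] ++ [seq shift p.+1 l
         | l <- [:: Cup 0; Disk 1 S; Cap 0; Cap (n.*2 - 2)]]).
    down 3 (cap (p + n.*2.-1)) (cap (p + 1)) (cap (p + n.*2.-1)).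
    rewrite addn0 !addn1 (_ : p.+1 + (n.*2 - 2) = p + n.*2.-1); last by lia.
    exact: reduces_refl.
  apply: (trivial_value_reduces (b := V ++ b) R T).
  rewrite -catA [a ++ _]catA => {}T.
  (* Gap [p+1] is shaded, as the second clause of uncappability requires. *)
  apply: (@trivial_value_vanish _ _ _ n.-1 false) T => //.
  + by rewrite /= negbK (negPf p_even).
  + by tangle.
  exact: uncap_S.2.
- case: (ltnP i n.*2) => Hi.
    have R : reduces 1
        [:: Cup p; Cup p.+1; Disk p.+2 S; Cap (p + n.*2.+1); Cap (p + i)]
        ([:: Cup p; Cup p.+1] ++ [:: Disk p.+2 S; Cap (p.+2 + (i - 2))]
         ++ [:: Cap (p + n.*2.-1)]).
      down 3 (cap (p + n.*2.-1)) (cap (p + i)) (cap (p + n.*2.-1)).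
      rewrite (_ : p.+2 + (i - 2) = p + i); last by lia.
      exact: reduces_refl.
    apply: (trivial_value_reduces (b := V ++ b) R T).
    rewrite -!catA catA => {}T.
    by apply: capped_disk_vanishes T; lia.
  have {}Hi : i = n.*2 by lia.
  rewrite {}Hi in T *.
  apply: (trivial_value_reduces (b := V ++ b) (disk_counterrotation p) T).
  by apply: Hg; split=> //; apply: generated_disk.
have {lt_i1} i0 : i = 0 by lia.
rewrite {}i0 addn0 in T *.
have R : reduces 1
    [:: Cup p; Cup p.+1; Disk p.+2 S; Cap (p + n.*2.+1); Cap p]
    [:: Cup p; Disk p S; Cap (p + n.*2.-1)].
  down 3 (cap (p + n.*2.-1)) (cap p) (cap (p + n.*2.-1)).
  down 2 (disk p) (cap p) (disk p).
  zigr 1.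
  exact: reduces_refl.
apply: (trivial_value_reduces (b := V ++ b) R T).
by apply: Hg; do !split; [constructor | apply: generated_disk | constructor].
Qed.

(** The scheme used for A, now with relation (5); the minima joining S to the inner arch lead back
    to A. *)
Lemma trivial_value_C a b p : ~~ odd p ->
  closed (a ++ [:: Cup p; Cup p.+1; Disk p.+2 S] ++ b) ->
  (forall g, generated (pred1 p) g -> closed (a ++ g ++ b) ->
     trivial_value (a ++ g ++ b)) ->
  trivial_value (a ++ [:: Cup p; Cup p.+1; Disk p.+2 S] ++ b).
Proof.
move=> p_even T Hg.
have EC : [:: Cup p; Cup p.+1; Disk p.+2 S]
    = [seq shift p l | l <- diagram_C S].
  by rewrite /= addn0 addn1 addn2.
rewrite EC in T *.
apply: (trivial_value_jones_wenzl d_neq0 f4P) relC T _ _ => //.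
- by tangle.
- apply: is_tangle_cat (_ : is_tangle true 0 (6 * n) [:: _; _; _]) _.
    by tangle.
  apply: is_tangle_cat (is_tangle_caps true (m := 6 * n) _) _; first by lia.
  have := @is_tangle_caps (box P) true n.+1 n.-1 (6 * n - n.-1.*2).
  have -> : 6 * n - n.-1.*2 - n.-1.*2 = n.+2.*2 by lia.
  by apply; lia.
- move=> v _; set V := [seq shift p l | l <- tl_embed _ v].
  rewrite /diagram_D !map_cat /= addn0 => T.
  have R : reduces 1 [:: Disk p S; Disk (p + n.*2) S; Disk (p + 4 * n) S]
      [:: Disk p S; Disk p S; Disk p S].
    up 1 (disk (p + n.*2)) (disk (p + n.*2)) (disk (p + n.*2)).
    up 0 (disk p) (disk p) (disk p).
    up 1 (disk p) (disk p) (disk p).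
    exact: reduces_refl.
  apply: (trivial_value_reduces R T) => {}T.
  have := Hg ([:: disk p; disk p; disk p] ++
    [seq shift p l | l <- caps (3 * n).+1 n.-1]
    ++ [seq shift p l | l <- caps n.+1 n.-1] ++ V).
  rewrite -!catA; rewrite -!catA in T; apply=> //; apply/generated_cat; split.
    by do !split; exact: generated_disk.
  do 2!(apply/generated_cat; split;
    first exact: (@generated_shift pred0) (generated_caps _ _ _)).
  exact: generated_embed.
move=> i v Tv /=; set V := [seq shift p l | l <- tl_embed _ v].
have lt_i : i.+1 < n.+2.*2.
  by move: Tv; rewrite /is_tl_word /is_tangle /=; case: ifP.
have {}Hg g : generated (pred1 p) g -> closed (a ++ g ++ V ++ b) ->
    trivial_value (a ++ g ++ V ++ b).
  move=> Gg; have := Hg (g ++ V); rewrite -!catA; apply.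
  by apply/generated_cat; split; last exact: generated_embed.
rewrite addn0 addn1 addn2 => {}T.
(* The minima 0 and 2n + 2 straighten an arch, 1 and 2n + 1 join the inner arch
   to S, which leaves a rotation of diagram A, and the other ones join
   neighbouring strings of S. *)
case: (ltngtP i 1) lt_i T => [lt_i1|lt_1i|->] lt_i T; last first.
(* Here the first string of S is led to the right; at the cost of a sign the last one is led to the
   left instead. *)
- rewrite addn1 in T *.
  have := trivial_value_reduces (a := a ++ [:: Cup p]) (b := V ++ b)
    (arch_rotation_inv p.+1).
  rewrite -!catA addSnnS; apply=> // {}T; exact: trivial_value_A.
- case: (ltngtP i n.*2.+1) => Hi.
  + have -> : p + i = p.+2 + (i - 2) by lia.
    have := @capped_disk_vanishes (a ++ [:: Cup p; Cup p.+1]) (V ++ b)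
      p.+2 (i - 2).
    rewrite -!catA; apply; first by lia.
    by rewrite (_ : p.+2 + (i - 2) = p + i) //; lia.
  + have {}Hi : i = n.*2.+2 by lia.
    rewrite {}Hi in T *.
    have R : reduces 1
        [:: Cup p; Cup p.+1; Disk p.+2 S; Cap (p + n.*2.+2)]
        [:: Disk p S; Cup p].
      up 2 (cap p.+2) (cap p.+2) (disk p.+2).
      zigl 1.
      up 0 (disk p) (disk p) (cup p).
      exact: reduces_refl.
    apply: (trivial_value_reduces (b := V ++ b) R T).
    by apply: Hg; do !split; [exact: generated_disk | constructor].
  by rewrite {}Hi in T *; apply: (trivial_value_A (b := V ++ b)).
have {lt_i1} i0 : i = 0 by lia.
rewrite {}i0 addn0 in T *.
have R : reduces 1 [:: Cup p; Cup p.+1; Disk p.+2 S; Cap p]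
    [:: Cup p; Disk p S].
  down 2 (disk p) (cap p) (disk p).
  zigr 1.
  exact: reduces_refl.
apply: (trivial_value_reduces (b := V ++ b) R T).
by apply: Hg; do !split; [constructor | exact: generated_disk].
Qed.

(* Straightening the zigzags formed by two strings to the left of S and two
   arches over S exhibits diagram C in the word [:: Disk p.+2 S]. *)
Lemma trivial_value_disk_left a b p : ~~ odd p ->
  closed (a ++ [:: Disk p.+2 S] ++ b) ->
  (forall g, generated (pred1 p) g -> closed (a ++ g ++ b) ->
     trivial_value (a ++ g ++ b)) ->
  trivial_value (a ++ [:: Disk p.+2 S] ++ b).
Proof.
move=> p_even T Hg.
have R : reduces 1 [:: Cup p; Cup p.+1; Disk p.+2 S; Cap (p + n.*2.+3);
    Cap (p + n.*2.+2)] [:: Disk p.+2 S].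
  up 2 (cap p.+3) (cap p.+3) (disk p.+2).
  up 3 (cap p.+2) (cap p.+2) (disk p.+2).
  up 1 (cap p.+1) (cap p.+1) (cup p.+1).
  zigl 0.
  zigl 0.
  exact: reduces_refl.
have T' : closed (a ++ [:: Cup p; Cup p.+1; Disk p.+2 S; Cap (p + n.*2.+3);
    Cap (p + n.*2.+2)] ++ b).
  move: T; rewrite /closed /is_tangle !target_cat.
  case: (target true 0 a) => //= m; case: ifP => //= /andP[Hp Ep].
  do !(rewrite ifT /=; last by (lia || (rewrite Ep andbT; lia))).
  by rewrite (_ : _ - 2 - 2 = m + n.*2)%N //; lia.
have [_ E] := reducesP R _ _ T'.
suff [c Ec] : trivial_value (a ++ [:: Cup p; Cup p.+1; Disk p.+2 S;
    Cap (p + n.*2.+3); Cap (p + n.*2.+2)] ++ b).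
  by exists c; rewrite -Ec E scale1r.
apply: (trivial_value_C (b := [:: _; _] ++ b)) => // g Gg.
have := Hg (g ++ [:: Cap (p + n.*2.+3); Cap (p + n.*2.+2)]).
rewrite -!catA; apply; apply/generated_cat; split=> //.
by do !split; constructor.
Qed.

(** * Sweeping all copies of S to the far left *)

Lemma generated_leq_or_split Q j w : generated Q w ->
  generated (leq^~ j) w \/
  exists a b p, [/\ w = a ++ [:: Disk p S] ++ b, j < p, Q p,
                     generated Q a & generated Q b].
Proof.
elim: w => [|l w IH] /=; first by left.
case=> Hl Gw.
case: (IH Gw) => [Gjw|[a [b [p [-> lt_jp Qp Ga Gb]]]]]; last first.
  by right; exists (l :: a), b, p.
case: l / Hl => [p|p|p Qp]; try by left; split=> //; constructor.
have [le_pj|lt_jp] := leqP p j; first by left; split=> //; constructor.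
by right; exists [::], w, p.
Qed.

Lemma generated_bounded w : generated predT w ->
  exists j, generated (leq^~ j) w.
Proof.
elim: w => [|l w IH] /=; first by exists 0.
case=> Hl /IH[j Gw]; case: l / Hl => [p|p|p _].
- by exists j; split=> //; constructor.
- by exists j; split=> //; constructor.
exists (maxn p j); split; first by constructor; exact: leq_maxl.
by apply: generated_sub Gw => q; rewrite -!topredE /=; lia.
Qed.

Definition disks_right_of j w : nat :=
  count (fun l => if l is @Disk _ p _ _ _ then j < p else false) w.

Lemma generated_leq_disks_right_of j w :
  generated (leq^~ j) w -> disks_right_of j w = 0.
Proof.
elim: w => //= l w IH [Hl /IH]; rewrite /disks_right_of /= => ->.
by case: Hl => //= p; rewrite ltnNge => ->.
Qed.

(** Outer induction on a bound [2j] for the gaps holding disks, inner induction on the number of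
    disks beyond the next smaller bound. Moving one such disk may create many copies, but all of
    them within that bound, so the inner count drops. *)
Lemma trivial_value_generated :
  (forall w, generated (pred1 0) w -> closed w -> trivial_value w) ->
  forall w, generated predT w -> closed w -> trivial_value w.
Proof.
move=> H0 w /generated_bounded[j Gw].
have {}Gw : generated (leq^~ j.*2) w.
  by apply: generated_sub Gw => q; rewrite -!topredE /=; lia.
elim: j w Gw => [|j IHj] w Gw.
  apply: H0; apply: generated_sub Gw => q; rewrite -!topredE /=.
  by rewrite leqn0.
have [N] := ubnP (disks_right_of j.*2 w); elim: N w Gw => // N IHN w Gw lt_N T.
have [Gw'|[a [b [p [Ew lt_jp le_pj Ga Gb]]]]] :=
  generated_leq_or_split j.*2 Gw; first exact: IHj.
rewrite {}Ew in lt_N T *.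
have p_even : ~~ odd p.
  move: T; rewrite /closed /is_tangle target_cat.
  by case: (target true 0 a) => //= m; case: ifP => // /andP[].
(* S sits in an unshaded gap, so [p] is even, and [2j < p <= 2j+2]. *)
have Ep : p = j.*2.+2 by lia.
rewrite {}Ep in lt_N T *.
apply: trivial_value_disk_left => //; first by rewrite odd_double.
move=> g Gg; apply: IHN.
  do 2!(apply/generated_cat; split=> //).
  by apply: generated_sub Gg => q; rewrite -!topredE /= => /eqP->; lia.
have Eg : disks_right_of j.*2 g = 0.
  apply/generated_leq_disks_right_of/(generated_sub _ Gg) => q.
  by rewrite -!topredE /= => /eqP->.
by move: lt_N Eg; rewrite /disks_right_of !count_cat /= => lt_N ->; lia.
Qed.

End Arches.
End Rotation.

(** * Removing S *)

Section Square.
Variable f : tl_sum K.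
Hypotheses (f_tl : is_tl n f) (S_square : box_mul S S = tl_box P n f).

Lemma caps_cap_left p k x : x.+2 <= p ->
  reduces 1 (caps p k ++ [:: Cap x]) (Cap x :: caps (p - 2) k).
Proof.
elim: k p => [|k IH] p lt_xp; first exact: reduces_refl.
rewrite !capsS -catA; apply: (@reduces_trans1 _ _ _ _ _ _ _ _ _
  (caps p.+1 k ++ [:: Cap x; Cap (p - 2)])).
  by apply/reduces_catl/(exchange_down phiP (l0 := Cap (p - 2))); layer_eq.
have := reduces_catr [:: Cap (p - 2)] (IH p.+1 (leqW lt_xp)).
by rewrite -catA /= (_ : p.+1 - 2 = (p - 2).+1); last by lia.
Qed.

Lemma caps_cap_right p k x : p <= x ->
  reduces 1 (caps p k ++ [:: Cap x]) (Cap (x + k.*2) :: caps p k).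
Proof.
elim: k p x => [|k IH] p x le_px; first by rewrite addn0; exact: reduces_refl.
rewrite !capsS -catA; apply: (@reduces_trans1 _ _ _ _ _ _ _ _ _
  (caps p.+1 k ++ [:: Cap x.+2; Cap p])).
  by apply/reduces_catl/(exchange_up phiP (l0 := Cap x)); layer_eq.
have := reduces_catr [:: Cap p] (IH p.+1 x.+2 (leqW le_px)).
by rewrite -catA /= (_ : x.+2 + k.*2 = x + k.+1.*2); last by lia.
Qed.

Lemma caps_disk p k :
  reduces 1 (caps p k ++ [:: Disk 0 S]) (Disk 0 S :: caps (n.*2 + p) k).
Proof.
elim: k p => [|k IH] p; first exact: reduces_refl.
rewrite !capsS -catA; apply: (@reduces_trans1 _ _ _ _ _ _ _ _ _
  (caps p.+1 k ++ [:: Disk 0 S; Cap (n.*2 + p)])).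
  by apply/reduces_catl/(exchange_down phiP (l0 := Cap p)); layer_eq.
have := reduces_catr [:: Cap (n.*2 + p)] (IH p.+1).
by rewrite -catA /= addnS.
Qed.

Lemma cap_caps q k x : q + k.*2 <= x ->
  reduces 1 (Cap x :: caps q k) (caps q k ++ [:: Cap (x - k.*2)]).
Proof.
elim: k q => [|k IH] q le_qx; first by rewrite subn0; exact: reduces_refl.
rewrite !capsS -catA; apply: (@reduces_trans1 _ _ _ _ _ _ _ _ _
  (caps q.+1 k ++ [:: Cap (x - k.*2); Cap q])).
  have := reduces_catr [:: Cap q] (IH q.+1 _); rewrite -catA /=.
  by apply; lia.
apply/reduces_catl/(exchange_down phiP (l0 := Cap (x - k.+1.*2))); layer_eq.
Qed.

Lemma caps_caps p j q k : q + k.*2 <= p ->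
  reduces 1 (caps p j ++ caps q k) (caps q k ++ caps (p - k.*2) j).
Proof.
elim: j p => [|j IH] p le_qp; first by rewrite cats0; exact: reduces_refl.
rewrite !capsS -catA; apply: (@reduces_trans1 _ _ _ _ _ _ _ _ _
  (caps p.+1 j ++ caps q k ++ [:: Cap (p - k.*2)])).
  exact/reduces_catl/cap_caps.
have := reduces_catr [:: Cap (p - k.*2)] (IH p.+1 (leqW le_qp)).
by rewrite -!catA (_ : p.+1 - k.*2 = (p - k.*2).+1); last by lia.
Qed.

(** Two copies joined by [n] strings form the box [S S], which by relation (3) is a combination of
    pictures without disks. *)
Lemma trivial_value_square a b :
  closed (a ++ [:: Disk 0 S; Disk n.*2 S] ++ caps n n ++ b) ->
  (forall v, closed (a ++ cups 0 n ++ tl_embed (box P) v ++ b) ->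
     trivial_value (a ++ cups 0 n ++ tl_embed (box P) v ++ b)) ->
  trivial_value (a ++ [:: Disk 0 S; Disk n.*2 S] ++ caps n n ++ b).
Proof.
move=> T Hv.
pose w : seq (layer (box P)) := [:: Disk 0 S; Disk n.*2 S] ++ caps n n.
have Tw : is_tangle true 0 n.*2 w.
  apply: is_tangle_cat (_ : is_tangle true 0 (4 * n) [:: _; _]) _.
    by tangle.
  have := @is_tangle_caps (box P) true n n (4 * n).
  by rewrite (_ : 4 * n - n.*2 = n.*2); [apply|]; lia.
have {}T : closed (a ++ [seq shift 0 l | l <- w] ++ b).
  by rewrite shift0 -catA.
have Td x : closed (a ++ [:: Disk 0 (x : P n true)] ++ b).
  exact: closed_extract Tw T.
have Tcups : is_tangle true 0 n.*2 (cups 0 n : seq (layer (box P))).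
  exact: is_tangle_cups.
(* In [tl_box] the [n] top strings are bent to the right, so [f] acts on the first [n] of [2n]
   strings. *)
have f_tl2 : is_tl n.*2 f.
  apply: sub_all f_tl => cv; rewrite -addnn; exact: is_tangle_widen.
have cups0 : cups 0 n <> [::] :> seq (layer (box P)) by case: (n) n_gt0.
have Tc v : is_tl_word n.*2 v ->
    closed (a ++ cups 0 n ++ tl_embed (box P) v ++ b).
  move=> Tv; have := closed_insert (Td 0%R) (is_tangle_cat Tcups
    (_ : is_tangle true _ _ (tl_embed _ v))).
  by rewrite shift0 -!catA; apply; rewrite is_tangle_embed.
have w0 : w <> [::] by [].
have := @act_insert a b 0 n true w (erefl _) w0 Tw T.
rewrite -/(box_mul S S) S_square /tl_box.
rewrite -(act_insert_tl _ cups0 Tcups f_tl2) //;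
  last exact: closed_insert (Td 0%R) Tcups.
rewrite !shift0 /w -catA /trivial_value => ->.
apply: (trivial_value_linear (Q := is_tl_word n.*2)) f_tl2 _ => v Tv.
by rewrite !shift0 -catA; apply/Hv/Tc.
Qed.

(** * Rows of copies of S and the minima below them *)

Definition disks w : nat :=
  count (fun l => if l is @Disk _ _ _ _ _ then true else false) w.

Lemma disks_cat u w : disks (u ++ w) = disks u + disks w.
Proof. exact: count_cat. Qed.

Lemma disks_caps p k : disks (caps p k) = 0.
Proof. by elim: k p => // k IH p; rewrite capsS disks_cat IH. Qed.

Lemma disks_cups p k : disks (cups p k) = 0.
Proof. by elim: k p => //= k IH p; exact: IH. Qed.

Lemma disks_embed v : disks (tl_embed (box P) v) = 0.
Proof. by elim: v => //= -[p|p|p k t []]. Qed.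

Lemma generated_tl Q v : generated Q (tl_embed (box P) v).
Proof. by rewrite -[tl_embed _ v]shift0; exact: generated_embed. Qed.

(* Rows of disks in which consecutive disks are joined by fewer than n strings,
   so that every disk keeps at least two free strings. *)
Inductive chain : nat -> nat -> seq (layer (box P)) -> Prop :=
| Chain1 : chain 1 n.*2 [:: Disk 0 S]
| ChainS r m w c : chain r m w -> c < n ->
    chain r.+1 (n.*2 + m - c.*2)
          (w ++ [:: Disk 0 S] ++ caps (n.*2 - c) c).

(** A new disk brings [2n] strings and its joins consume [2c < 2n], so the number of free strings
    only grows from [2n] on. *)
Lemma chain_tangle r m w : chain r m w -> is_tangle true 0 m w /\ n < m.
Proof.
elim=> {r m w} [|r m w c Hw [Tw lt_nm] lt_cn].
  by split; [tangle | lia].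
split; last by lia.
apply: is_tangle_cat Tw (is_tangle_cat (_ : is_tangle _ _ (n.*2 + m) _) _).
  by tangle.
by apply: is_tangle_caps; lia.
Qed.

Lemma chain_generated r m w : chain r m w -> generated (pred1 0) w.
Proof.
elim=> {r m w} [|r m w c _ Gw _]; first by split; [exact: generated_disk|].
apply/generated_cat; split=> //=; split; first exact: generated_disk.
exact: generated_caps.
Qed.

Lemma chain_disks r m w : chain r m w -> disks w = r.
Proof.
elim=> {r m w} // r m w c _ Gw _; rewrite !disks_cat Gw disks_caps /=.
by rewrite addn1.
Qed.

Lemma chain_last r m w : chain r m w ->
  exists w0 c, [/\ w = w0 ++ [:: Disk 0 S] ++ caps (n.*2 - c) c, c < n,
                    generated (pred1 0) w0 & (disks w0).+1 = r].
Proof.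
case=> {r m w} [|r m w c Hw lt_cn]; first by exists [::], 0.
by exists w, c; split; rewrite ?(chain_disks Hw) //; apply: chain_generated Hw.
Qed.

(** The disk added last is leftmost. A minimum among its free strings gives 0; one further right
    rises past this disk into the shorter chain; one between it and the next disk adds a join, and
    the [n]-th join removes both disks. *)
Lemma chain_cap r m w : chain r m w -> forall x b,
  closed (w ++ [:: Cap x] ++ b) ->
  (forall m' w', chain r m' w' -> closed (w' ++ b) ->
     trivial_value (w' ++ b)) ->
  (forall g, generated (pred1 0) g -> disks g < r -> closed (g ++ b) ->
     trivial_value (g ++ b)) ->
  trivial_value (w ++ [:: Cap x] ++ b).
Proof.
elim=> {r m w} [|r m w c Hw IH lt_cn] x b T Hchain Hless.
  have := @capped_disk_vanishes [::] b 0 x; apply=> //.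
  by move: T; rewrite /closed /is_tangle /=; case: ifP => //= _; case: ifP.
case: (ltngtP x.+1 (n.*2 - c)) => Hx; rewrite -!catA in T *.
- have R := reduces_catl [:: Disk 0 S] (@caps_cap_left (n.*2 - c) c x Hx).
  have := trivial_value_reduces (a := w) (b := b) R.
  rewrite -!catA; apply=> // {}T.
  apply: (@capped_disk_vanishes w (caps _ c ++ b) 0 x) => //.
  by lia.
- have R1 : reduces 1 ([:: Disk 0 S] ++ caps (n.*2 - c) c ++ [:: Cap x])
      ([:: Disk 0 S] ++ (Cap (x + c.*2) :: caps (n.*2 - c) c)).
    by apply/reduces_catl/caps_cap_right; lia.
  have R2 : reduces 1 [:: Disk 0 S; Cap (x + c.*2)]
      [:: Cap (x + c.*2 - n.*2); Disk 0 S].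
    by apply: (exchange_up phiP (l0 := Cap (x + c.*2 - n.*2))); layer_eq.
  have := trivial_value_reduces (a := w) (b := b)
    (reduces_trans1 R1 (reduces_catr (caps (n.*2 - c) c) R2)).
  rewrite -!catA; apply=> // {}T.
  apply: (IH (x + c.*2 - n.*2) ([:: Disk 0 S] ++ caps (n.*2 - c) c ++ b)) => //.
    move=> m' w' Hw' T'; have := Hchain _ _ (ChainS Hw' lt_cn).
    by rewrite -!catA; apply.
  move=> g Gg lt_gr T'; have := Hless (g ++ [:: Disk 0 S] ++ caps (n.*2 - c) c).
  rewrite -!catA; apply=> //.
    apply/generated_cat; split=> //=; split; first exact: generated_disk.
    exact: generated_caps.
  by rewrite !disks_cat disks_caps /=; lia.
have Ecaps : caps (n.*2 - c) c ++ [:: Cap x] = caps (n.*2 - c.+1) c.+1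
    :> seq (layer (box P)).
  have -> : x = n.*2 - c.+1 by lia.
  by rewrite capsS; congr (caps _ c ++ _); lia.
rewrite (catA (caps _ c)) Ecaps in T *.
case: (ltngtP c.+1 n) => Hc; first 2 [by lia].
  have := Hchain _ _ (ChainS Hw Hc); rewrite -!catA; exact.
have Enc : n.*2 - c.+1 = n by lia.
rewrite Enc {}Hc in T *.
have [w0 [c0 [Ew lt_c0n Gw0 Dw0]]] := chain_last Hw.
rewrite {}Ew -!catA in T *.
(* The joins of the second disk to the rest of the row are slid below the new disk and its [n]
   minima. As [c0 < n], the second disk has enough free strings to receive all of these minima. *)
have R1 : reduces 1
    ((caps (n.*2 - c0) c0 ++ [:: Disk 0 S]) ++ caps n n)
    ([:: Disk 0 S] ++ caps n n ++ caps (n.*2 - c0) c0).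
  apply: reduces_trans1 (reduces_catr _ (caps_disk _ _)) _.
  apply: (reduces_catl [:: Disk 0 S]).
  have := @caps_caps (n.*2 + (n.*2 - c0)) c0 n n; rewrite addKn; apply.
  by lia.
have R2 : reduces 1 [:: Disk 0 S; Disk 0 S] [:: Disk 0 S; Disk n.*2 S].
  by apply: (exchange_down phiP (l0 := disk 0)); layer_eq.
have := trivial_value_reduces (a := w0) (b := b) (reduces_trans1
  (reduces_catl [:: Disk 0 S] R1)
  (reduces_catr (caps n n ++ caps (n.*2 - c0) c0) R2)).
rewrite -!catA; apply=> // {}T.
apply: trivial_value_square T _ => v.
have := Hless (w0 ++ cups 0 n ++ tl_embed _ v ++ caps (n.*2 - c0) c0).
rewrite -!catA; apply.
  do ?[apply/generated_cat; split=> //]; [exact: generated_cups |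
    exact: generated_tl | exact: generated_caps].
by rewrite !disks_cat disks_cups disks_embed disks_caps; lia.
Qed.

(** If the minima ran out with all copies still present, more than [n] strings would be left, so a
    closed picture must lose copies on the way. *)
Lemma chain_caps r : (forall w, generated (pred1 0) w -> disks w < r ->
    closed w -> trivial_value w) ->
  forall us m w, chain r m w -> closed (w ++ map Cap us) ->
    trivial_value (w ++ map Cap us).
Proof.
move=> Hless; elim=> [|x us IH] m w Hw T.
  have [Tw lt_nm] := chain_tangle Hw; rewrite cats0 in T.
  by have := is_tangle_inj Tw T; lia.
have {}IH m' w' : chain r m' w' -> closed (w' ++ map Cap us) ->
  trivial_value (w' ++ map Cap us) := @IH m' w'.
apply: (chain_cap (x := x) (b := map Cap us) Hw) => // g Gg lt_g; apply: Hless.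
  apply/generated_cat; split=> //.
  by elim: (us) => //= j us' IHus; split=> //; constructor.
by rewrite disks_cat (_ : disks (map Cap us) = 0) ?addn0 //; elim: (us).
Qed.

Lemma chain_nseq r : exists m, chain r.+1 m (nseq r.+1 (disk 0)).
Proof.
elim: r => [|r [m Hr]]; first by exists n.*2; exact: Chain1.
(* The new disk is not joined to the row: [c = 0]. *)
exists (n.*2 + m - 0.*2); have := ChainS Hr n_gt0.
by rewrite subn0 !cats0 -[_ ++ _]/(nseq r.+1 _ ++ nseq 1 _) -nseqD addn1.
Qed.

Lemma layer_past_disks (l : layer (box P)) r :
  reduces 1 (l :: nseq r (disk 0)) (nseq r (disk 0) ++ [:: shift (r * n.*2) l]).
Proof.
have sh0 (l' : layer (box P)) : shift 0 l' = l' by case: l'.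
elim: r l => [|r IH] l; first by rewrite mul0n sh0; exact: reduces_refl.
have R : reduces 1 [:: l; disk 0] [:: disk 0; shift n.*2 l].
  exact: (exchange_down phiP (l0 := l)).
apply: (reduces_trans1 (reduces_catr (nseq r (disk 0)) R)).
have := reduces_catl [:: disk 0] (IH (shift n.*2 l)).
by rewrite shift_shift mulSn addnC.
Qed.

(** A disk in gap 0 lies to the left of every feature above it, so it can be raised to the top. *)
Lemma disks_first w : generated (pred1 0) w ->
  exists2 u, flat u & reduces 1 w (nseq (disks w) (disk 0) ++ u).
Proof.
elim: w => [|l w IH] /=; first by exists [::] => //; exact: reduces_refl.
case=> Hl /IH[u Fu R].
case: l / Hl => [p|p|p /eqP->]; last first.
- by exists u => //; exact: (reduces_catl [:: disk 0] R).
- exists (shift (disks w * n.*2) (Cap p) :: u) => //.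
  apply: (reduces_trans1 (reduces_catl [:: Cap p] R)).
  have := reduces_catr u (layer_past_disks (Cap p) (disks w)).
  by rewrite -catA.
exists (shift (disks w * n.*2) (Cup p) :: u) => //.
apply: (reduces_trans1 (reduces_catl [:: Cup p] R)).
have := reduces_catr u (layer_past_disks (Cup p) (disks w)).
by rewrite -catA.
Qed.

Lemma trivial_value_left w :
  generated (pred1 0) w -> closed w -> trivial_value w.
Proof.
have [r] := ubnP (disks w); elim: r w => // r IH w lt_r Gw T.
have [u Fu R] := disks_first Gw.
have [c [us [ws Hu]]] := flat_normal_form d Fu.
have := trivial_value_reduces (a := [::]) (b := [::])
  (reduces_trans1 R (reduces_catl _ (Hu _ _ _ _ _ phiP))).
rewrite !cats0; apply=> // {}T.
(* A final maximum would leave strings at the bottom of a closed picture. *)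
case/lastP: ws T {Hu} => [|ws j]; last first.
  rewrite map_rcons -cats1 !catA; case/is_tangle_catP=> m _.
  by rewrite /is_tangle /=; case: ifP.
rewrite cats0; case Er: (disks w) => [|k] T.
  (* Without disks a first minimum would find no strings to join, so the word is empty. *)
  case: us T => [|i us]; last by rewrite /closed /is_tangle /=.
  by move=> _; exists 1%R; rewrite scale1r.
have [m Hk] := chain_nseq k.
apply: chain_caps Hk T => w' Gw' lt_w'; apply: IH => //.
by rewrite Er in lt_r; lia.
Qed.

End Square.
End ClosedDiagrams.

(** * From diagrams in S to the whole space of closed boxes *)

Lemma qint2 (K : fieldType) (q : K) : q != 0%R -> qint q 2 = (q + q^-1)%R.
Proof.
move=> q0; rewrite /qint; case: eqP => [E|/eqP E].
  by rewrite expr1 -E mulr_natl mulr2n.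
by rewrite -exprVn subr_sqr mulrC mulKf // subr_eq0.
Qed.

Lemma generated_diagram (K : fieldType) (P : planarAlgebra K) n (S : P n true)
    s m w : is_diagram S s m w -> generated S predT w.
Proof.
case=> _; elim: w => //= -[p|p|p k t x] w IH /=.
- by move=> /IH; split=> //; constructor.
- by move=> /IH; split=> //; constructor.
case=> Hx /IH; split=> //; case: k t x / Hx; exact: GenDisk.
Qed.

Local Open Scope ring_scope.
Local Open Scope complex_scope.

Theorem theorem3p8 (R : realType) (q : R[i]) (n : nat)
    (P : planarAlgebra R[i]) (S : P n true) (fn f2n2 f2n4 : tl_sum R[i])
    (q_neq0 : q != 0)
    (n_gt0 : (0 < n)%N)
    (qint_neq0 : forall m, (1 <= m <= 2 * n + 4)%N -> qint q m != 0)
    (modulusP : has_modulus P (q + q^-1))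
    (empty_neq0 : forall s, empty_diagram P s != 0)
    (generatedP : singly_generated S)
    (jw_n : is_jones_wenzl (q + q^-1) n fn)
    (jw_2n2 : is_jones_wenzl (q + q^-1) (2 * n + 2) f2n2)
    (jw_2n4 : is_jones_wenzl (q + q^-1) (2 * n + 4) f2n4)
    (rel1 : rho S = - S)
    (rel2 : uncappable S)
    (rel3 : box_mul S S = tl_box P n fn)
    (rel4 : act_then_tl true n.+1 (diagram_A S) f2n2
            = ('i%R * sqrtC (qint q n * qint q n.+2) / qint q n.+1)
              *: act_then_tl true n.+1 (diagram_B S) f2n2)
    (rel5 : act_then_tl true n.+2 (diagram_C S) f2n4
            = (qint q 2 * qint q (2 * n + 4) / (qint q n.+1 * qint q n.+2))
              *: act_then_tl true n.+2 (diagram_D S) f2n4) :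
  (forall w : seq (layer (box P)), is_diagram S true 0 w ->
     exists c : R[i], act P true 0 w = c *: empty_diagram P true) /\
  one_dimensional (P 0%N true).
Proof.
(* The modulus is [[2]], one of the quantum integers assumed nonzero. *)
have d_neq0 : q + q^-1 != 0 by rewrite -qint2 // qint_neq0 //; lia.
have E2 : (2 * n + 2 = n.+1.*2)%N by lia.
have E4 : (2 * n + 4 = n.+2.*2)%N by lia.
rewrite E2 in jw_2n2; rewrite E4 in jw_2n4.
have fn_tl : is_tl n fn by case: jw_n.
have trivialP w : is_diagram S true 0 w ->
    exists c : R[i], act P true 0 w = c *: empty_diagram P true.
  move=> Hw; apply: (trivial_value_generated modulusP n_gt0 rel2 rel1 d_neq0
    jw_2n2 jw_2n4 rel4 rel5 _ (generated_diagram Hw) Hw.1) => u.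
  exact: (trivial_value_left modulusP n_gt0 rel2 fn_tl rel3).
split=> //; exists (empty_diagram P true) => // x.
(* Single generation writes [x] as a combination of closed diagrams, each a multiple of the empty
   one. *)
have [r [c [w [Hw ->]]]] := generatedP true 0%N x.
elim/big_ind: _ => [|y z [cy ->] [cz ->]|i _].
- by exists 0; rewrite scale0r.
- by exists (cy + cz); rewrite scalerDl.
by have [ci ->] := trivialP _ (Hw i); exists (c i * ci); rewrite scalerA.
Qed.
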